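(* Every 2-bridge knot $K_{p/q}$ of genus one satisfies the Hirasawa–Murasugi conjecture (in its strong form) for every odd prime $\ell$ dividing $q$. That is, there are representatives $\tilde\Delta(t)$ of the $\ell$-twisted Alexander polynomial of $K_{p/q}$ (defined up to $\pm t^{r\ell}$, $r\in\mathbb Z$) and $\Delta(t)$ of the Alexander polynomial of $K_{p/q}$ (defined up to $\pm t^{r}$, $r\in\mathbb Z$) and an integer Laurent polynomial $f(t)$ such that $$\tilde\Delta(t)=\frac{\Delta(t)}{t-1}f(t)f(-t)\qquad\text{and}\qquad f(t)\equiv\left(\frac{\Delta(t)}{t+1}\right)^{\frac{\ell-1}{2}}\pmod\ell.$$
   Context: For odd coprime integers $0<p<q$, $K_{p/q}$ is the corresponding 2-bridge knot and $\epsilon_i=(-1)^{\lfloor ip/q\rfloor}$. It is known that the genus-one 2-bridge knots are exactly the $K_{p/q}$ with $\frac pq=\frac{4rs-2s-1}{4rs-1}$ or $\frac pq=\frac{4rs-2s+1}{4rs+1}$ for natural numbers $r,s$. One representative of the Alexander polynomial is $1-t^{\epsilon_1}+t^{\epsilon_1+\epsilon_2}-\dots+t^{\epsilon_1+\dots+\epsilon_{q-1}}$. The congruence mod $\ell$ means $(t+1)^{(\ell-1)/2}f(t)\equiv\Delta(t)^{(\ell-1)/2}$ coefficientwise mod $\ell$. The knot group is $G_{p/q}=\langle a,b\mid aw=wb\rangle$ with $w=b^{\epsilon_1}a^{\epsilon_2}b^{\epsilon_3}\cdots a^{\epsilon_{q-1}}$. The dihedral group is $D_\ell=\langle x,y\mid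 x^2=1,\ y^\ell=1,\ yx=xy^{-1}\rangle$. Fix $\pi:D_\ell\to GL(\ell,\mathbb C)$ with $\pi(x)=F$, the matrix with ones on the antidiagonal and zeros elsewhere, and $\pi(y)=R$, the matrix with ones in positions $(1,\ell)$ and $(i+1,i)$, $1\le i<\ell$, and zeros elsewhere. Let $\rho:G_{p/q}\to D_\ell$ be any surjective homomorphism and $\phi=\pi\circ\rho$. With $\partial w/\partial a$ the Fox derivative, let $$\hat A_\phi=I+(t\phi(a)-I)\left.\frac{\partial w}{\partial a}\right|_{a=t\phi(a),\,b=t\phi(b)}$$ (the group ring element $1$ is replaced by the identity matrix). The $\ell$-twisted Alexander polynomial is $\det\hat A_\phi/\det(t\phi(b)-I)$, considered up to factors $\pm t^{r\ell}$; up to such factors it does not depend on $\rho$. *)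

(* Defs.v *)
From HB Require Import structures.
From mathcomp Require Import all_boot all_order all_algebra.
From mathcomp Require Import generic_quotient monoid.
From mathcomp Require Import finmap.
From mathcomp Require Import boolp reals.
From mathcomp.real_closed Require Export complex.

Set Implicit Arguments.
Unset Strict Implicit.
Unset Printing Implicit Defensive.

Import Order.TTheory GRing.Theory Num.Theory.

Local Open Scope ring_scope.
Local Open Scope quotient_scope.

(** * Groups given by generators and relations *)

(* The letter (x, false) stands for the generator x and (x, true) for its
   inverse; a word is a product of letters read from left to right. *)
Definition letter (X : Type) : Type := (X * bool)%type.
Definition word (X : Type) : Type := seq (letter X).

Definition invl (X : Type) (l : letter X) : letter X := (l.1, ~~ l.2).
Definition invw (X : Type) (w : word X) : word X := rev (map (@invl X) w).

(* A relation is a pair of words (u, v), meaning u = v. *)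
Inductive pres_eqv (X : choiceType) (rels : seq (word X * word X)) :
    word X -> word X -> Prop :=
| pres_refl u : pres_eqv rels u u
| pres_sym u v : pres_eqv rels u v -> pres_eqv rels v u
| pres_trans u v w :
    pres_eqv rels u v -> pres_eqv rels v w -> pres_eqv rels u w
| pres_cat u u' v v' :
    pres_eqv rels u u' -> pres_eqv rels v v' ->
    pres_eqv rels (u ++ v) (u' ++ v')
| pres_cancel l : pres_eqv rels [:: l; invl l] [::]
| pres_rel r : r \in rels -> pres_eqv rels r.1 r.2.

Section PresentedGroup.
Variables (X : choiceType) (rels : seq (word X * word X)).

Definition pres_eqb : rel (word X) := fun u v => `[< pres_eqv rels u v >].

Lemma pres_eqb_refl : reflexive pres_eqb.
Proof. by move=> u; apply/asboolP; apply: pres_refl. Qed.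

Lemma pres_eqb_sym : symmetric pres_eqb.
Proof. by move=> u v; apply/asboolP/asboolP; apply: pres_sym. Qed.

Lemma pres_eqb_trans : transitive pres_eqb.
Proof.
by move=> v u w /asboolP uv /asboolP vw; apply/asboolP; apply: pres_trans vw.
Qed.

Canonical pres_equiv :=
  EquivRel pres_eqb pres_eqb_refl pres_eqb_sym pres_eqb_trans.

Definition presented := {eq_quot pres_equiv}.

HB.instance Definition _ := Choice.on presented.
HB.instance Definition _ := EqQuotient.on presented.

Definition pres_class (w : word X) : presented := \pi_presented w.

Definition pres_gen (x : X) : presented := pres_class [:: (x, false)].

Definition pres_one : presented := pres_class [::].
Definition pres_mul (g h : presented) : presented :=
  pres_class (repr g ++ repr h).
Definition pres_inv (g : presented) : presented := pres_class (invw (repr g)).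

Lemma pres_classP u v : pres_class u = pres_class v <-> pres_eqv rels u v.
Proof. by split=> [/eqmodP/asboolP | uv]; [|apply/eqmodP/asboolP]. Qed.

Lemma pres_classK (g : presented) : pres_class (repr g) = g.
Proof. exact: reprK. Qed.

Lemma repr_pres_class w : pres_eqv rels (repr (pres_class w)) w.
Proof. by apply/pres_classP; rewrite pres_classK. Qed.

Lemma pres_mulE u v :
  pres_mul (pres_class u) (pres_class v) = pres_class (u ++ v).
Proof. by apply/pres_classP; apply: pres_cat; apply: repr_pres_class. Qed.

Lemma invwK : involutive (@invw X).
Proof.
move=> w; rewrite /invw map_rev revK -map_comp -[RHS]map_id.
by apply: eq_map => -[x e]; rewrite /= /invl negbK.
Qed.

Lemma pres_invwr w : pres_eqv rels (w ++ invw w) [::].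
Proof.
elim: w => [|l w IHw]; first exact: pres_refl.
rewrite /invw map_cons rev_cons -cats1 catA -/(invw w) /=.
apply: (@pres_trans _ _ _ ([:: l] ++ [::] ++ [:: invl l])).
  rewrite -!cat_cons -cat1s -!catA; apply: pres_cat; first exact: pres_refl.
  by rewrite catA; apply: pres_cat => //; apply: pres_refl.
exact: pres_cancel.
Qed.

Fact pres_mulA : associative pres_mul.
Proof.
move=> g h k; rewrite -(pres_classK g) -(pres_classK h) -(pres_classK k).
by rewrite !pres_mulE catA.
Qed.

Fact pres_mul1g : left_id pres_one pres_mul.
Proof. by move=> g; rewrite -(pres_classK g) pres_mulE. Qed.

Fact pres_mulg1 : right_id pres_one pres_mul.
Proof. by move=> g; rewrite -(pres_classK g) pres_mulE cats0. Qed.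

Fact pres_mulVg : left_inverse pres_one pres_inv pres_mul.
Proof.
move=> g; rewrite -[X in pres_mul _ X]pres_classK pres_mulE.
by apply/pres_classP; rewrite -{2}(invwK (repr g)); apply: pres_invwr.
Qed.

Fact pres_mulgV : right_inverse pres_one pres_inv pres_mul.
Proof.
move=> g; rewrite -[X in pres_mul X _]pres_classK pres_mulE.
by apply/pres_classP; apply: pres_invwr.
Qed.

HB.instance Definition _ := isGroup.Build presented
  pres_mulA pres_mul1g pres_mulg1 pres_mulVg pres_mulgV.

End PresentedGroup.

(** * Fox calculus *)

(* Fox derivative with respect to the generator x, as an element of the
   integral group ring of the free group: the list of the (c, u) stands for the
   formal sum of the c u. It follows from dx/dx = 1, dy/dx = 0 for a generator
   y <> x, d(x^-1)/dx = - x^-1 and d(uv)/dx = du/dx + u dv/dx. *)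
Fixpoint fox (X : eqType) (x : X) (w : word X) : seq (int * word X) :=
  if w is l :: w' then
    (if l.1 == x then
       if l.2 then [:: (-1, [:: (x, true)])] else [:: (1, [::])]
     else [::])
    ++ [seq (c.1, l :: c.2) | c <- fox x w']
  else [::].

Definition eval_word (X : Type) (K : fieldType) (n : nat) (M : X -> 'M[K]_n)
    (w : word X) : 'M[K]_n :=
  foldr (fun l A => (if l.2 then invmx (M l.1) else M l.1) *m A) 1%:M w.

Definition eval_sum (X : Type) (K : fieldType) (n : nat) (M : X -> 'M[K]_n)
    (s : seq (int * word X)) : 'M[K]_n :=
  \sum_(c <- s) c.1%:~R *: eval_word M c.2.

(** * 2-bridge knots *)

(* Genus-one 2-bridge knots, through their known list. *)
Definition genus_one (p q : nat) : Prop :=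
  exists r s : nat, [/\ (0 < r)%N, (0 < s)%N &
    (p%:R / q%:R = (4 * r%:R * s%:R - 2 * s%:R - 1) / (4 * r%:R * s%:R - 1)
       :> rat) \/
    (p%:R / q%:R = (4 * r%:R * s%:R - 2 * s%:R + 1) / (4 * r%:R * s%:R + 1)
       :> rat)].

Definition eps (p q i : nat) : int := (-1) ^+ (i * p %/ q)%N.

(* The two generators of the knot group. *)
Definition gen_a : bool := false.
Definition gen_b : bool := true.

(* w = b^eps_1 a^eps_2 b^eps_3 ... a^eps_(q-1) *)
Definition knot_word (p q : nat) : word bool :=
  [seq ((if odd i then gen_b else gen_a), eps p q i == -1) | i <- iota 1 q.-1].

Definition knot_group (p q : nat) : groupType :=
  presented [:: ((gen_a, false) :: knot_word p q,
                 rcons (knot_word p q) (gen_b, false))].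

(** * Dihedral groups *)

Definition gen_x : bool := false.
Definition gen_y : bool := true.

Definition dihedral_rels (l : nat) : seq (word bool * word bool) :=
  [:: ([:: (gen_x, false); (gen_x, false)], [::]);
      (nseq l (gen_y, false), [::]);
      ([:: (gen_y, false); (gen_x, false)], [:: (gen_x, false); (gen_y, true)])].

Definition dihedral (l : nat) : groupType := presented (dihedral_rels l).
Definition dih_x (l : nat) : dihedral l := pres_gen (dihedral_rels l) gen_x.
Definition dih_y (l : nat) : dihedral l := pres_gen (dihedral_rels l) gen_y.

(* Indices of matrices start at 0. *)
Definition antidiag_mx (K : fieldType) (l : nat) : 'M[K]_l :=
  \matrix_(i, j) ((i + j)%N == l.-1)%:R.

Definition shift_mx (K : fieldType) (l : nat) : 'M[K]_l :=
  \matrix_(i, j) (((i == 0%N :> nat) && (j == l.-1 :> nat))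
                  || (i == j.+1 :> nat))%:R.

(* A homomorphism from G to GL(n, K); the values of such a map are
   automatically invertible. *)
Definition is_representation (K : fieldType) (G : groupType) (n : nat)
    (f : G -> 'M[K]_n) : Prop :=
  f 1%g = 1%:M /\ forall g h : G, f (g * h)%g = f g *m f h.

Definition is_pi (K : fieldType) (l : nat) (f : dihedral l -> 'M[K]_l) : Prop :=
  [/\ is_representation f, f (dih_x l) = antidiag_mx K l
    & f (dih_y l) = shift_mx K l].

(** * Laurent polynomials *)

(* Laurent polynomials over K are handled inside the field K(t). *)
Notation ratfun K := {fraction {poly K}}.

Definition tvar (K : fieldType) : ratfun K := tofrac 'X.
Definition const_rf (K : fieldType) (c : K) : ratfun K := tofrac c%:P.

(* An integer Laurent polynomial, as its finitely supported coefficient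
   function: f k is the coefficient of t^k. *)
Notation int_laurent := {fsfun int -> int with 0}.

Definition laurent_at (F : fieldType) (f : int_laurent) (z : F) : F :=
  \sum_(k <- finsupp f) (f k)%:~R * z ^ k.

(* Coefficientwise congruence modulo m of integer Laurent polynomials. *)
Definition laurent_congr (K : fieldType) (m : nat) (u v : ratfun K) : Prop :=
  exists h : int_laurent,
    u - v = laurent_at h (tvar K) /\ forall k, (m%:Z %| h k)%Z.

Definition equal_up_to (K : fieldType) (d : nat) (u v : ratfun K) : Prop :=
  exists (e : bool) (r : int), u = (-1) ^+ e * tvar K ^ (r * d%:Z) * v.

(** * Alexander polynomials *)

(* 1 - t^eps_1 + t^(eps_1 + eps_2) - ... + t^(eps_1 + ... + eps_(q-1)) *)
Definition alexander (K : fieldType) (p q : nat) : ratfun K :=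
  \sum_(0 <= i < q) (-1) ^+ i * tvar K ^ (\sum_(1 <= j < i.+1) eps p q j).

Section TwistedAlexander.
Variables (K : fieldType) (p q n : nat) (phi : knot_group p q -> 'M[K]_n).

Let I : 'M[ratfun K]_n := 1%:M.

(* t phi(g), for a generator g of the knot group *)
Definition t_phi (x : bool) : 'M[ratfun K]_n :=
  tvar K *: map_mx (@const_rf K) (phi (pres_gen _ x)).

Definition A_hat : 'M[ratfun K]_n :=
  I + (t_phi gen_a - I) *m eval_sum t_phi (fox gen_a (knot_word p q)).

Definition twisted_alexander : ratfun K := \det A_hat / \det (t_phi gen_b - I).

End TwistedAlexander.

(* Main.v *)
(* Write q = 4rs -+ 1, so that p = q - 2s, and let A, B be the images of a, b,
   which are two distinct reflections of Z/l. The letters of w alternate in such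
   a way that w only involves powers of the rotation S = AB, and the Fox
   derivative becomes a product of two geometric sums. Up to multiples of the
   all-ones matrix these sums are inverses of (1 + S^r)(1 + S^e), e = +-2rs, and
   A_hat becomes (t^-1 A + S^e)(1 + t A) divided by (1 + S^r)(1 + S^e), up to a
   factor t A. The all-ones matrix only affects the trivial summand, which
   contributes Delta = t + c (t - 1)^2 with c = +-rs and 4c - 1 = +-q. Hence the
   twisted polynomial is Delta / (t - 1) * (1 - t^2)^m up to a unit, with
   m = (l - 1)/2, and f = (1 + t)^m works: 4 Delta = (t + 1)^2 modulo l, while
   4^m = 1 modulo l. Determinants are compared through their squares, because
   signs are immaterial. *)

Require Import Defs.
From mathcomp Require Import all_boot all_order all_algebra.
From mathcomp Require Import monoid finmap reals.
From mathcomp Require Import boolp ring lra zify.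

Set Implicit Arguments.
Unset Strict Implicit.
Unset Printing Implicit Defensive.

Import Order.TTheory GRing.Theory Num.Theory.
Local Open Scope ring_scope.

(** * Permutation matrices of the dihedral group acting on Z/l, where l is [n.+2] *)

Section DihedralMatrices.
Variables (K : fieldType) (n : nat).
Implicit Types (a b k u : 'I_n.+2) (M A : 'M[K]_n.+2) (c x t : K).

(** The size [n.+2] makes the index set the ring Z/l. As permutations, [rot k] is [j |-> j + k] and
    [refl a] is [j |-> a - j]. *)
Definition rot k : 'M[K]_n.+2 := \matrix_(i, j) (i == j + k)%:R.
Definition refl a : 'M[K]_n.+2 := \matrix_(i, j) (i + j == a)%:R.
Definition ones : 'M[K]_n.+2 := const_mx 1.

Lemma sum_delta (T : finType) (y : T) (F : T -> K) :
  \sum_j F j * (j == y)%:R = F y.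
Proof.
rewrite (bigD1 y) //= eqxx mulr1 big1 ?addr0 // => j /negbTE ->.
by rewrite mulr0.
Qed.

Lemma mulmx_rot M k i j : (M * rot k) i j = M i (j + k).
Proof. by rewrite mxE; under eq_bigr => h _ do rewrite mxE; rewrite sum_delta. Qed.

Lemma mulmx_refl M a i j : (M * refl a) i j = M i (a - j).
Proof.
rewrite mxE; under eq_bigr => h _ do
  rewrite mxE eq_sym -subr_eq eq_sym.
by rewrite sum_delta.
Qed.

Lemma rot0 : rot 0 = 1.
Proof. by apply/matrixP => i j; rewrite !mxE addr0. Qed.

Lemma rotM a b : rot a * rot b = rot (a + b).
Proof.
by apply/matrixP => i j; rewrite mulmx_rot !mxE -addrA [b + a]addrC.
Qed.

Lemma rot_refl a b : rot a * refl b = refl (a + b).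
Proof.
apply/matrixP => i j; rewrite mulmx_refl !mxE.
have -> : (i + j == a + b) = (i == a + b - j) by rewrite eq_sym -subr_eq eq_sym.
by rewrite [b - j + a]addrC addrA.
Qed.

Lemma refl_rot a b : refl a * rot b = refl (a - b).
Proof.
apply/matrixP => i j; rewrite mulmx_rot !mxE.
have -> : (i + j == a - b) = (i + j + b == a) by rewrite eq_sym subr_eq eq_sym.
by rewrite addrA.
Qed.

Lemma reflM a b : refl a * refl b = rot (a - b).
Proof.
apply/matrixP => i j; rewrite mulmx_refl !mxE.
by rewrite [in LHS]eq_sym -(subr_eq a) eq_sym opprB addrCA.
Qed.

Lemma refl_sqr a : refl a * refl a = 1.
Proof. by rewrite reflM subrr rot0. Qed.

Lemma rot_unit k : rot k \is a GRing.unit.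
Proof. by apply/unitrP; exists (rot (- k)); rewrite !rotM addNr subrr rot0. Qed.

Lemma rotV k : (rot k)^-1 = rot (- k).
Proof.
by apply: (mulrI (rot_unit k)); rewrite divrr ?rot_unit // rotM subrr rot0.
Qed.

Lemma rotX k m : rot k ^+ m = rot (k *+ m).
Proof. by elim: m => [|m IHm]; rewrite ?rot0 // exprS IHm rotM mulrS. Qed.

Lemma refl_unit a : refl a \is a GRing.unit.
Proof. by apply/unitrP; exists (refl a); rewrite !refl_sqr. Qed.

Lemma reflV a : (refl a)^-1 = refl a.
Proof. by apply: (mulrI (refl_unit a)); rewrite divrr ?refl_unit // refl_sqr. Qed.

Lemma ones_rot k : ones * rot k = ones.
Proof. by apply/matrixP => i j; rewrite mulmx_rot !mxE. Qed.

Lemma ones_refl a : ones * refl a = ones.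
Proof. by apply/matrixP => i j; rewrite mulmx_refl !mxE. Qed.

Lemma rot_ones k : rot k * ones = ones.
Proof.
apply/matrixP => i j; rewrite !mxE; under eq_bigr => h _ do
  rewrite !mxE mulr1 -subr_eq eq_sym -[_%:R]mul1r.
by rewrite sum_delta.
Qed.

Lemma refl_ones a : refl a * ones = ones.
Proof.
apply/matrixP => i j; rewrite !mxE; under eq_bigr => h _ do
  rewrite !mxE mulr1 eq_sym addrC -subr_eq eq_sym -[_%:R]mul1r.
by rewrite sum_delta.
Qed.

Lemma ones_sqr : ones * ones = n.+2%:R *: ones.
Proof.
apply/matrixP => i j; rewrite !mxE; under eq_bigr do rewrite !mxE mulr1.
by rewrite sumr_const card_ord mulr1.
Qed.

Lemma double_eq (a i : 'I_n.+2) : (2%:R : 'I_n.+2) \is a GRing.unit ->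
  (i *+ 2 == a) = (i == a / 2%:R).
Proof.
by move=> u2; rewrite -[i *+ 2]mulr_natr -[RHS](can_eq (mulrK u2)) divrK.
Qed.

(** Sylvester's identity [det (1 + u v) = det (1 + v u)] for a column [u] and a row [v], obtained by
    multiplying two block matrices in both orders. *)
Lemma det_add1_ones c : \det (1 + c *: ones) = 1 + n.+2%:R * c.
Proof.
pose u : 'cV[K]_n.+2 := const_mx c; pose v : 'rV[K]_n.+2 := const_mx 1.
have uv : u *m v = c *: ones.
  by apply/matrixP => i j; rewrite !mxE big_ord1 !mxE.
have vu : v *m u = (n.+2%:R * c)%:M.
  apply/matrixP => i j; rewrite !ord1 !mxE; under eq_bigr do rewrite !mxE mul1r.
  by rewrite sumr_const card_ord mulr1n mulr_natl.
have E1 : block_mx 1%:M (- u) v 1%:M *m block_mx 1%:M u 0 1%:M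
   = block_mx (1%:M : 'M_n.+2) 0 v (1%:M + v *m u).
  by rewrite mulmx_block !mulmx1 !mul1mx !mulmx0 !addr0 subrr [v *m u + _]addrC.
have E2 : block_mx 1%:M u 0 1%:M *m block_mx 1%:M (- u) v 1%:M
   = block_mx (1%:M + u *m v) 0 v (1%:M : 'M_1).
  by rewrite mulmx_block !mulmx1 !mul1mx !mul0mx !add0r addNr.
have := det_mulmx (block_mx 1%:M (- u) v 1%:M) (block_mx 1%:M u 0 1%:M).
rewrite mulrC -det_mulmx E1 E2 !det_lblock !det1 mul1r mulr1 uv vu => <-.
by rewrite -raddfD /= det_scalar1.
Qed.

(** The perturbed matrix factors as [M * (1 + (c / x) *: ones)]: only the eigenvalue [x] of the
    constant vector moves, to [x + l c]. *)
Lemma det_add_ones M c x : x != 0 -> M * ones = x *: ones ->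
  \det (M + c *: ones) * x = \det M * (x + n.+2%:R * c).
Proof.
move=> x0 Mx; have -> : M + c *: ones = M * (1 + (c / x) *: ones).
  by rewrite mulrDr mulr1 -scalerAr Mx scalerA divfK.
rewrite [\det _]det_mulmx det_add1_ones -mulrA; congr (_ * _).
by rewrite mulrDl mul1r -mulrA divfK.
Qed.

End DihedralMatrices.

(** * Determinants of circulant matrices and of [1 + t A] for a reflection [A] *)

Lemma unit_two_ord (n : nat) : odd n -> (2%:R : 'I_n.+2) \is a GRing.unit.
Proof. by move=> n_odd; rewrite (@unitZpE n.+2 2) // coprimen2 /= negbK. Qed.

Section CyclicDeterminants.
Variables (K : fieldType) (n : nat).
Implicit Types (a b k u : 'I_n.+2) (M A : 'M[K]_n.+2) (c x t : K).
Hypothesis n_odd : odd n.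
Let u2 := unit_two_ord n_odd.
Hypothesis l0 : n.+2%:R != 0 :> K.

Local Notation J := (ones K n).
Local Notation rot := (@rot K n).
Local Notation refl := (@refl K n).

Lemma natr_ord (i : 'I_n.+2) : i%:R = i.
Proof. exact: natr_Zp. Qed.

(** Multiplication by a unit permutes Z/l, so each entry receives exactly one contribution. *)
Lemma sum_rot u : u \is a GRing.unit -> \sum_(i < n.+2) rot (u *+ i) = J.
Proof.
move=> uu; apply/matrixP => i j; rewrite summxE mxE.
rewrite (eq_bigr (fun h : 'I_n.+2 => 1 * (h == u^-1 * (i - j))%:R)).
  by rewrite sum_delta.
move=> h _; rewrite mxE mul1r -[u *+ h]mulr_natr natr_ord [j + _]addrC -subr_eq eq_sym.
by rewrite -(can_eq (mulKr uu) h) mulVKr.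
Qed.

(** A row vector [v] in the kernel is killed by [ones], hence fixed by [rot u]; summing over all
    powers of [rot u] then gives [l v = v J = 0]. *)
Lemma det_sub_rot_neq0 u : u \is a GRing.unit -> \det (1 - rot u + J) != 0.
Proof.
move=> uu; apply/det0P => -[v v0]; rewrite mulmxDr mulmxBr mulmx1 => vE.
have vJ : v *m J = 0.
  have: (v - v *m rot u + v *m J) *m J = 0 by rewrite vE mul0mx.
  rewrite mulmxDl mulmxBl -!mulmxA [rot u *m J]rot_ones subrr add0r.
  rewrite [J *m J]ones_sqr -scalemxAr => /eqP.
  by rewrite scaler_eq0 (negbTE l0) => /eqP.
have vT i : v *m rot (u *+ i) = v.
  elim: i => [|i IHi]; first by rewrite mulr0n rot0 mulmx1.
  rewrite mulrSr -rotM [v *m _]mulmxA IHi; apply/esym/eqP.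
  by rewrite -subr_eq0 -[v - _]addr0 -{1}vJ vE.
move/eqP: vJ; rewrite -(sum_rot uu) mulmx_sumr (eq_bigr (fun=> v)) => [|i _].
  by rewrite sumr_const card_ord -scaler_nat scaler_eq0 (negbTE l0) (negbTE v0).
exact: vT.
Qed.

(* Conjugation by the permutation [i |-> 2 i] turns [rot u] into [rot (u * 2)]. *)
Lemma det_sub_rot_double u :
  \det (1 - rot (u *+ 2) + J) = \det (1 - rot u + J).
Proof.
pose D : 'M[K]_n.+2 := \matrix_(i, j) (i == j *+ 2)%:R.
(* [E] is a left inverse of [D], since 2 is a unit in Z/l; this makes [\det D] nonzero. *)
pose E : 'M[K]_n.+2 := \matrix_(i, j) (i *+ 2 == j)%:R.
have mulE M i j : (M * D) i j = M i (j *+ 2).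
  by rewrite mxE; under eq_bigr => h _ do rewrite mxE; rewrite sum_delta.
have ED : E * D = 1.
  by apply/matrixP => i j; rewrite mulE !mxE double_eq // -[j *+ 2]mulr_natr mulrK.
have DJ : D * J = J.
  apply/matrixP => i j; rewrite !mxE.
  rewrite (eq_bigr (fun h : 'I_n.+2 => 1 * (h == i / 2%:R)%:R)) ?sum_delta //.
  by move=> h _; rewrite !mxE mulr1 mul1r eq_sym double_eq.
have comm : D * (1 - rot u + J) = (1 - rot (u *+ 2) + J) * D.
  rewrite mulrDr mulrBr mulr1 DJ.
  have entry (M N P : 'M[K]_n.+2) i j : (M - N + P) i j = M i j - N i j + P i j.
    by rewrite !mxE.
  by apply/matrixP => i j; rewrite mulE !entry mulmx_rot !mxE mulrnDl.
have dD : \det D != 0.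
  apply/negP => /eqP dD; have := congr1 determinant ED.
  by rewrite [LHS]det_mulmx dD mulr0 det1 => /eqP; rewrite eq_sym oner_eq0.
apply: (mulIf dD); rewrite -[LHS]det_mulmx -[_ *m _]comm [LHS]det_mulmx.
exact: mulrC.
Qed.

(** With [S] for [rot u], [(1 - S + J) (1 + S) = (1 - S^2 + J) + J]. Doubling the angle preserves
    the determinant of [1 - S + J], and the extra [J] doubles the eigenvalue l of the constant
    vector. *)
Lemma det_add_rot u : u \is a GRing.unit -> \det (1 + rot u) = 2%:R.
Proof.
move=> uu.
have E : (1 - rot u + J) * (1 + rot u) = (1 - rot (u *+ 2) + J) + 1 *: J.
  rewrite mulrDr mulr1 mulrDl mulrBl mul1r rotM ones_rot -mulr2n scale1r.
  by rewrite addrACA [1 - _ + _]addrA subrK addrA.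
have := congr1 determinant E; rewrite [LHS]det_mulmx => E'.
apply: (mulfI (det_sub_rot_neq0 uu)).
apply: (mulIf l0); rewrite {}E'.
have MJ : (1 - rot (u *+ 2) + J) * J = n.+2%:R *: J.
  by rewrite mulrDl mulrBl mul1r rot_ones subrr add0r ones_sqr.
rewrite [LHS](det_add_ones 1 l0 MJ) det_sub_rot_double -mulrA.
by congr (_ * _); rewrite mulr1 mulr_natl mulr2n.
Qed.

(* [rot 1 - rot (- 1)] anticommutes with [refl a] and is invertible modulo
   [ones], so [1 + t R] and [1 - t R] have the same determinant off the trivial
   summand. *)
Lemma det_add_refl_sqr a t : t != 1 ->
  \det (1 + t *: refl a) ^+ 2 = ((1 + t) * (1 - t ^+ 2) ^+ (n.+1)./2) ^+ 2.
Proof.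
move=> t1; have t1' : 1 - t != 0 by rewrite subr_eq0 eq_sym.
pose A := refl a; pose Z := rot 1 - rot (- 1); pose Y := Z - J.
have ZA : Z * A = - (A * Z).
  by rewrite mulrBr mulrBl !refl_rot !rot_refl opprB opprK [a + 1]addrC [a - 1]addrC.
have ZJ : Z * J = 0 by rewrite mulrBl !rot_ones subrr.
(* This makes [Y] invertible: up to the unit [- rot (- 1)] it is a circulant matrix with known
   nonzero determinant. *)
have YE : Y = - rot (- 1) * (1 - rot (1 *+ 2) + J).
  rewrite mulrDr mulrBr !mulNr mulr1 rotM rot_ones opprK mulr2n addKr.
  by rewrite [- _ + _]addrC.
have Y0 : \det Y != 0.
  rewrite YE [\det _]det_mulmx mulf_neq0 //; last first.
    by rewrite det_sub_rot_double det_sub_rot_neq0 // unitr1.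
  by rewrite -unitfE -[_ \is a _]unitmxE unitrN rot_unit.
have E : Y * (1 + t *: A) = (1 - t *: A) * Y + (- (2%:R * t)) *: J.
  have YA : Y * A = - (A * Z) - J by rewrite mulrBl ZA ones_refl.
  have AY : A * Y = A * Z - J by rewrite mulrBr refl_ones.
  rewrite mulrDr mulr1 -scalerAr YA mulrBl mul1r -scalerAl AY !scalerBr scalerN.
  rewrite opprB -[RHS]addrA; congr (_ + _); rewrite addrAC -scalerDl [RHS]addrC.
  by congr (_ + _); rewrite -scaleNr; congr (_ *: _); ring.
have EJ : (1 - t *: A) * Y * J = (- (n.+2%:R * (1 - t))) *: J.
  have YJ : Y * J = - (n.+2%:R *: J) by rewrite mulrBl ZJ sub0r ones_sqr.
  rewrite -mulrA YJ mulrN -scalerAr mulrBl mul1r -scalerAl refl_ones.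
  by rewrite scaleNr -scalerA scalerBl scale1r.
have l1 : - (n.+2%:R * (1 - t)) != 0 by rewrite oppr_eq0 mulf_neq0.
have := det_add_ones (- (2%:R * t)) l1 EJ; rewrite -E ![\det (_ * _)]det_mulmx.
move=> E2.
(* The constant vector has eigenvalue [1 + t] for one matrix and [1 - t] for the other, whence the
   two extra factors. *)
have E3 : \det (1 + t *: A) * (1 - t) = \det (1 - t *: A) * (1 + t).
  apply: (mulfI Y0); apply: (mulfI l0); apply: oppr_inj.
  transitivity (\det Y * \det (1 + t *: A) * - (n.+2%:R * (1 - t))).
    by ring.
  by rewrite E2; ring.
have E4 : \det (1 - t *: A) * \det (1 + t *: A) = (1 - t ^+ 2) ^+ n.+2.
  rewrite -[LHS]det_mulmx -det_scalar; congr (\det _).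
  rewrite [LHS]mulrDr mulr1 mulrBl mul1r -scalerAl -scalerAr refl_sqr scalerA.
  by rewrite addrA subrK -scalemx1 scalerBl scale1r.
(* Eliminating [\det (1 - t *: A)] between [E3] and [E4] leaves a formula for the square. *)
apply: (mulIf t1'); transitivity (\det (1 + t *: A) * (\det (1 + t *: A) * (1 - t))).
  by ring.
rewrite E3 mulrCA mulrA E4.
have -> : (1 - t ^+ 2) ^+ n.+2 = (1 - t ^+ 2) * ((1 - t ^+ 2) ^+ (n.+1)./2) ^+ 2.
  by rewrite -exprM muln2 even_halfK ?exprS //= n_odd.
by move: (_ ^+ (n.+1)./2) => X; ring.
Qed.

End CyclicDeterminants.

(** * The dihedral determinant behind the twisted polynomial *)

Section DihedralDeterminant.
Variables (K : fieldType) (n : nat).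
Hypothesis n_odd : odd n.
Hypothesis l0 : n.+2%:R != 0 :> K.
Hypothesis two0 : 2%:R != 0 :> K.

Local Notation J := (ones K n).
Local Notation rot := (@rot K n).
Local Notation refl := (@refl K n).

Lemma det_refl_sqr a : \det (refl a) ^+ 2 = 1.
Proof. by rewrite expr2 -[LHS]det_mulmx [_ *m _]refl_sqr det1. Qed.

(* Modulo [ones] one has [P (1 + rot x) (1 + rot y) = 1], so that multiplying
   by [(1 + rot x) (1 + rot y)] turns the matrix into
   [(t^-1 A + rot y) (1 + t A)] up to a multiple of [ones]. *)
Lemma det_dihedral_sqr a x y (P : 'M[K]_n.+2) (j c t : K) :
  x \is a GRing.unit -> y \is a GRing.unit ->
  (1 + rot x) * (1 + rot y) * P = 1 + j *: J -> n.+2%:R * j = 4%:R * c - 1 ->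
  t != 0 -> t != 1 -> t != -1 ->
  \det (1 + (t *: refl a - 1) * P * (rot x - t^-1 *: refl a)) ^+ 2 =
  (t ^- n.+2 * (t + c * (t - 1) ^+ 2) * (1 - t ^+ 2) ^+ n.+1) ^+ 2.
Proof.
move=> xu yu HP lj t0 t1 tN1.
set A := refl a; set X := 1 + _; pose H := (1 + rot x) * (1 + rot y).
(* [k] is the multiple of [ones] left over after multiplication by [H], and [lam] is the eigenvalue
   of [(t^-1 A + rot y) (1 + t A)] on the constant vector. *)
pose k := j * ((t - 1) ^+ 2 / t); pose lam := (1 + t) ^+ 2 / t.
have t1' : 1 + t != 0 by rewrite addrC -[1]opprK subr_eq0.
have lam0 : lam != 0 by rewrite mulf_neq0 ?invr_neq0 ?expf_neq0.
(* Moving [A] across [1 + rot x] gives [1 + rot (- x)], which is [rot (- x)] times [1 + rot x]. *)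
have HA : H * A = A * rot (- x - y) * H.
  rewrite /H !mulrDr !mulrDl !mul1r !mulr1 !mulrDr !mulr1 !rotM !rot_refl !refl_rot.
  have -> : a - (- x - y) = x + y + a by ring.
  have -> : x + y + a - x = y + a by ring.
  have -> : x + y + a - y = x + a by ring.
  have -> : x + y + a - (x + y) = a by ring.
  by rewrite [LHS](AC (2*2) ((4*3)*(2*1))).
have AB : (t^-1 *: A + rot y) * (1 + t *: A) =
    1 + rot y + t *: (A * rot (- y)) + t^-1 *: A.
  rewrite mulrDr mulr1 mulrDl -!scalerAl -!scalerAr refl_sqr scalerA mulVf //.
  rewrite scale1r refl_rot opprK rot_refl [y + a]addrC.
  by rewrite (AC (2*2) (3*2*4*1)).
have HX : H * X = (t^-1 *: A + rot y) * (1 + t *: A) + k *: J.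
  have HT : H * (t *: A - 1) = (t *: refl (a + (x + y)) - 1) * H.
    rewrite mulrBr mulr1 -scalerAr HA refl_rot mulrBl mul1r scalerAl.
    by rewrite -opprD opprK.
  have JX : J * (rot x - t^-1 *: A) = (1 - t^-1) *: J.
    by rewrite mulrBr -scalerAr ones_rot ones_refl scalerBl scale1r.
  have GX : (t *: refl (a + (x + y)) - 1) * (rot x - t^-1 *: A) =
      t *: refl (a + y) - rot (x + y) - rot x + t^-1 *: A.
    rewrite mulrBr !mulrBl !mul1r -!scalerAl -scalerAr refl_rot reflM scalerA.
    rewrite divff // scale1r opprB addrA.
    have -> : a + (x + y) - a = x + y by ring.
    have -> : a + (x + y) - x = a + y by ring.
    by rewrite (AC (2*1*1) (1*4*2*3)).
  rewrite /X mulrDr mulr1 2!mulrA HT -[_ * H * P]mulrA HP.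
  rewrite [(_ - 1) * (1 + _)]mulrDr mulr1.
  rewrite -scalerAr [(_ - 1) * J]mulrBl mul1r -scalerAl refl_ones.
  rewrite -{2}[J]scale1r -scalerBl scalerA mulrDl -scalerAl GX JX AB scalerA.
  have -> : j * (t - 1) * (1 - t^-1) = k by rewrite /k; field; exact: t0.
  rewrite addrA; congr (_ + _); rewrite refl_rot opprK.
  rewrite /H mulrDr mulr1 mulrDl mul1r rotM.
  rewrite [LHS](AC ((2*2)*4) (((1*3)*5*8)*(2*7)*(4*6))).
  by rewrite /= !subrr !addr0.
have NJ : (t^-1 *: A + rot y) * (1 + t *: A) * J = lam *: J.
  rewrite AB !mulrDl mul1r rot_ones -!scalerAl -mulrA rot_ones refl_ones.
  rewrite -{1 2}[J]scale1r -!scalerDl; congr (_ *: _); rewrite /lam; field.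
  exact: t0.
have dH : \det H = 4%:R.
  rewrite [LHS]det_mulmx !det_add_rot //; ring.
(* Taking out [t^-1 A] leaves [1 + t R] for a reflection [R] and produces the power [t^-l]. *)
have dN : \det (t^-1 *: A + rot y) ^+ 2 =
    (t ^- n.+2 * \det (1 + t *: refl (a - y))) ^+ 2.
  have -> : t^-1 *: A + rot y = A * (t^-1 *: (1 + t *: refl (a - y))).
    rewrite -scalerAr mulrDr mulr1 -scalerAr scalerDr scalerA mulVf // scale1r.
    by rewrite reflM opprB addrCA subrr addr0.
  by rewrite [\det _]det_mulmx exprMn det_refl_sqr mul1r detZ exprVn.
have := det_add_ones k lam0 NJ; rewrite -HX [\det (H * _)]det_mulmx dH.
rewrite [\det (_ * (1 + _))]det_mulmx.
(* Here the Alexander polynomial appears, since [(1 + t)^2 + (4 c - 1) (t - 1)^2 = 4 (t + c (t -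
   1)^2)]. *)
have -> : lam + n.+2%:R * k = 4%:R * ((t + c * (t - 1) ^+ 2) / t).
  by rewrite /lam /k mulrA lj; field; exact: t0.
move/(congr1 (fun z => z ^+ 2)); rewrite !exprMn dN exprMn !det_add_refl_sqr //.
have -> : (1 - t ^+ 2) ^+ n.+1 = ((1 - t ^+ 2) ^+ (n.+1)./2) ^+ 2.
  by rewrite -exprM muln2 even_halfK //= n_odd.
move: (_ ^+ (n.+1)./2) => Y E.
(* The common factor is the square of [\det H] times the square of [lam]. *)
apply: (@mulfI _ (4%:R ^+ 2 * ((1 + t) ^+ 4 * t^-1 ^+ 2))).
  have -> : 4%:R = 2%:R ^+ 2 :> K by ring.
  by rewrite mulf_neq0 ?mulf_neq0 ?expf_neq0 ?invr_neq0.
move: (\det X) E => d E.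
transitivity (4%:R ^+ 2 * d ^+ 2 * ((1 + t) ^+ 2 * (1 + t) ^+ 2 * t^-1 ^+ 2)).
  by move: t^-1 => ti; ring.
by rewrite E; move: (t ^- _) t^-1 => tn ti; ring.
Qed.

End DihedralDeterminant.

(** * Fox derivatives of periodic words *)

Definition word_exp (X : Type) (w : word X) (m : nat) : word X :=
  flatten (nseq m w).

Section FoxEvaluation.
Variables (X : eqType) (K : fieldType) (n : nat) (M : X -> 'M[K]_n.+1) (x : X).
Implicit Types (l : letter X) (u v w : word X).

Local Notation ev := (eval_word M).
Local Notation dev w := (eval_sum M (fox x w)).

Lemma eval_word_cat u v : ev (u ++ v) = ev u * ev v.
Proof. by elim: u => [|l u IHu]; rewrite ?mul1r //= IHu [LHS]mulrA. Qed.

Lemma eval_sum_cat (s1 s2 : seq (int * word X)) :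
  eval_sum M (s1 ++ s2) = eval_sum M s1 + eval_sum M s2.
Proof. by rewrite /eval_sum big_cat. Qed.

Lemma fox_cons l w : dev (l :: w) = dev [:: l] + ev [:: l] * dev w.
Proof.
rewrite /= cats0 eval_sum_cat; congr (_ + _).
rewrite /eval_sum big_map mulr_sumr; apply: eq_bigr => c _ /=.
by rewrite mulmx1 [LHS]scalerAr.
Qed.

Lemma fox_cat u v : dev (u ++ v) = dev u + ev u * dev v.
Proof.
elim: u => [|l u IHu]; first by rewrite /= {2}/eval_sum big_nil add0r mul1r.
rewrite cat_cons fox_cons IHu [dev (l :: u)]fox_cons mulrDr addrA.
by rewrite -[l :: u]cat1s eval_word_cat mulrA.
Qed.

Lemma eval_word_exp w m : ev (word_exp w m) = ev w ^+ m.
Proof. by elim: m => [|m IHm] //=; rewrite eval_word_cat IHm exprS. Qed.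

(** Iterating the product rule turns a power into a geometric sum. *)
Lemma fox_exp w m : dev (word_exp w m) = (\sum_(i < m) ev w ^+ i) * dev w.
Proof.
elim: m => [|m IHm]; first by rewrite big_ord0 mul0r /eval_sum big_nil.
rewrite big_ord_recl expr0 mulrDl mul1r [word_exp w _]/= fox_cat IHm.
rewrite mulrA [ev w * \sum_(i < m) _]mulr_sumr.
by congr (_ + _); congr (_ * _); apply: eq_bigr => i _; rewrite -exprS.
Qed.

Lemma fox_gen : dev [:: (x, false)] = 1.
Proof. by rewrite /= eqxx /eval_sum big_seq1 scale1r. Qed.

Lemma fox_gen_inv : dev [:: (x, true)] = - (M x)^-1.
Proof. by rewrite /= eqxx /eval_sum big_seq1 /= mulmx1 scaleN1r. Qed.

Lemma fox_other y e : y != x -> dev [:: (y, e)] = 0.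
Proof. by move=> /negbTE yx; rewrite /= yx /eval_sum big_nil. Qed.

End FoxEvaluation.

Lemma sum_expr_comm (R : pzRingType) (z : R) r m :
  GRing.comm (\sum_(i < r) z ^+ i) (z ^+ m).
Proof. by apply/commr_sym/commr_sum => i _; apply/commrX/commr_sym/commrX. Qed.

Section TwoBridgeWords.
Variables (K : fieldType) (n : nat) (M : bool -> 'M[K]_n.+1).
Implicit Types (r s : nat) (S T : 'M[K]_n.+1).

Let al := M gen_a.
Let be := M gen_b.
Local Notation ev := (eval_word M).
Local Notation dev w := (eval_sum M (fox gen_a w)).

Definition two_bridge_word (u v : word bool) r s : word bool :=
  word_exp (word_exp u r ++ word_exp v r) s.

(** As [u] and [v] share the value [S], the block [u^r v^r] has value [S^(2 r)], and the sum of [r]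
    powers commutes with [S^r] and factors out. *)
Lemma fox_two_bridge S u v r s : ev u = S -> ev v = S ->
  dev (two_bridge_word u v r s) =
  (\sum_(i < s) S ^+ (2 * r * i)) * (\sum_(i < r) S ^+ i) * (dev u + S ^+ r * dev v).
Proof.
move=> uS vS; rewrite fox_exp fox_cat !fox_exp eval_word_cat !eval_word_exp uS vS.
rewrite -exprD addnn -mul2n -mulrA; congr (_ * _).
  by apply: eq_bigr => i _; rewrite -exprM.
by rewrite mulrDr !mulrA -sum_expr_comm.
Qed.

(** The padded word [a^-1 w b^-1] has derivative [a^-1 (dw/da - 1)], its last letter contributing
    nothing. Solving for [dw/da] leaves a factor [a] in front. *)
Lemma fox_word_first S w r s : al \is a GRing.unit ->
  al^-1 * be = S -> al * be^-1 = S ->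
  (gen_a, true) :: rcons w (gen_b, true) =
    two_bridge_word [:: (gen_a, true); (gen_b, false)]
      [:: (gen_a, false); (gen_b, true)] r s ->
  1 + (al - 1) * dev w =
  al * (1 + (al - 1) * ((\sum_(i < s) S ^+ (2 * r * i)) * (\sum_(i < r) S ^+ i))
    * (S ^+ r - al^-1)).
Proof.
move=> ua S1 S2 wE.
have: dev ((gen_a, true) :: rcons w (gen_b, true)) = al^-1 * (dev w - 1).
  rewrite -cats1 fox_cons fox_cat fox_gen_inv fox_other // mulr0 addr0.
  by rewrite /= mulmx1 mulrBr mulr1 addrC.
rewrite wE (@fox_two_bridge S); last 2 first.
- by rewrite /= mulmx1.
- by rewrite /= mulmx1.
rewrite ![dev [:: _; _]]fox_cons fox_gen fox_gen_inv !fox_other // !mulr0 !addr0.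
rewrite mulr1 [_ + S ^+ r]addrC -/al => dE.
have alK : al * ((al - 1) * al^-1) = al - 1.
  by rewrite mulrBl mul1r divrr // mulrBr mulr1 divrr.
rewrite -[_ * _ * (S ^+ r - _)]mulrA dE mulrDr mulr1 [_ * (al^-1 * _)]mulrA.
by rewrite [al * (_ * _)]mulrA alK mulrBr mulr1 addrCA subKr addrC.
Qed.

Lemma fox_word_second T w r s :
  be * al^-1 = T -> be^-1 * al = T ->
  w = two_bridge_word [:: (gen_b, false); (gen_a, true)]
      [:: (gen_b, true); (gen_a, false)] r s ->
  dev w = (\sum_(i < s) T ^+ (2 * r * i)) * (\sum_(i < r) T ^+ i)
    * (T ^+ r * be^-1 - T).
Proof.
move=> T1 T2 ->; rewrite (@fox_two_bridge T); last 2 first.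
- by rewrite /= mulmx1.
- by rewrite /= mulmx1.
rewrite ![dev [:: _; _]]fox_cons fox_gen fox_gen_inv !fox_other // !add0r.
by rewrite /= !mulmx1 mulr1 mulrN [M _ * _]T1 addrC.
Qed.

End TwoBridgeWords.

(** * Combinatorics of the knot word *)

Lemma map_iota_periodic (T : Type) (f : nat -> T) (L m : nat) :
  (forall i, f (L + i)%N = f i) ->
  [seq f i | i <- iota 0 (m * L)] = flatten (nseq m [seq f i | i <- iota 0 L]).
Proof.
move=> fL; elim: m => [|m IHm] //=.
rewrite mulSn iotaD add0n -[X in iota X (m * L)]addn0 iotaDl map_cat -IHm.
by rewrite -map_comp; congr (_ ++ _); apply: eq_map => i /=.
Qed.

(** Both parities have period [4 r]; they agree on the first half of a period and are opposite on
    the second. [h] stays free because the two families of knots read generator and sign off these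
    parities differently. *)
Lemma map_iota_blocks (T : Type) (h : bool -> bool -> T) (r s : nat) :
  (0 < r)%N ->
  [seq h (odd i) (odd (i + i %/ (2 * r))) | i <- iota 0 (4 * r * s)] =
  flatten (nseq s (flatten (nseq r [:: h false false; h true true]) ++
                   flatten (nseq r [:: h false true; h true false]))).
Proof.
move=> r0; have r2 : (0 < 2 * r)%N by rewrite muln_gt0.
rewrite [(4 * r * s)%N]mulnC (_ : (4 * r = 2 * r * 2)%N); last by rewrite mulnAC.
pose f i := h (odd i) (odd (i + i %/ (2 * r))).
have fL i : f (2 * r * 2 + i)%N = f i.
  rewrite /f [(_ * 2)%N]mulnC divnMDl // addnACA.
  by rewrite !oddD /= !addbF !addbb.
rewrite [LHS](map_iota_periodic s fL); congr (flatten (nseq s _)).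
rewrite muln2 -addnn iotaD map_cat add0n -{2}[(2 * r)%N]addn0 iotaDl -map_comp.
rewrite -(@map_iota_periodic _ (fun i => h (odd i) (odd i)) 2) => [|i]; last first.
  by rewrite !oddD.
rewrite -(@map_iota_periodic _ (fun i => h (odd i) (~~ odd i)) 2) => [|i]; last first.
  by rewrite !oddD.
rewrite [(r * 2)%N]mulnC; congr (_ ++ _).
  apply/eq_in_map => i; rewrite mem_iota => /andP[_ ir].
  by rewrite /f divn_small ?addn0.
apply/eq_in_map => i; rewrite mem_iota => /andP[_ ir] /=.
rewrite /f divnDl ?dvdnn // divnn r2 divn_small ?addn0 //.
by rewrite addn1 [odd _.+1]/= (oddD (2 * r)) oddM.
Qed.

Lemma knot_wordE p q : knot_word p q =
  [seq (odd i, odd (i * p %/ q)) | i <- iota 1 q.-1].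
Proof.
apply: eq_map => i; rewrite /eps -signr_odd.
by case: odd; case: odd.
Qed.

(* Since [p = q - 2 s], [i p / q] is [i] minus the ceiling of [2 s i / q], and
   [q / (2 s)] is close to [2 r]. *)
Lemma divn_first r s p q i : (0 < r)%N -> (0 < s)%N ->
  q.+1 = (4 * (r * s))%N -> q = (p + 2 * s)%N -> (0 < i < q)%N ->
  ((i * p) %/ q = i - (i %/ (2 * r)).+1)%N.
Proof.
move=> r0 s0 qE pE /andP[i0 iq]; have r2 : (1 < 2 * r)%N by lia.
have := divn_eq i (2 * r); have := ltn_pmod i (ltnW r2); have := ltn_Pdiv r2 i0.
(* The [k.+1] in the remainder below comes from [q] being one less than [4 r s]; the bound [k < 2 s]
   keeps that remainder nonnegative. *)
have: (i %/ (2 * r) < 2 * s)%N.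
  by rewrite ltn_divLR ?(ltnW r2) //; move: (ltnW iq); nia.
move: (i %/ _)%N (i %% _)%N => k j ks ki jr iE.
have si : (s * i = 2 * (k * (r * s)) + s * j)%N by rewrite iE; ring.
have sj : (s * j + s <= 2 * (r * s))%N 
  by rewrite -mulnSr (_ : 2 * (r * s) = s * (2 * r))%N ?leq_mul2l ?jr ?orbT //; ring.
(* As [i > 0], not both [k] and [j] vanish; this keeps the remainder below [q]. *)
have kj : (0 < k + s * j)%N by rewrite addn_gt0 muln_gt0 s0 /=; lia.
have -> : (i * p = (i - k.+1) * q + (4 * (r * s) - k.+1 - 2 * (s * j)))%N.
  have E1 : (i * p + 2 * (s * i) = i * q)%N by rewrite pE; ring.
  have E2 : (i * q = (i - k.+1) * q + k.+1 * q)%N by rewrite -mulnDl subnK.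
  have E3 : (k.+1 * q + k.+1 = 4 * (k * (r * s)) + 4 * (r * s))%N.
    by rewrite -mulnSr qE; ring.
  lia.
rewrite divnMDl ?divn_small ?addn0 //; lia.
Qed.

(** Again [p = q - 2 s]; with the index shifted by one, the ceiling of [2 s (i + 1) / q] is
    [i %/ (2 * r) + 1]. *)
Lemma divn_second r s p q i : (0 < r)%N -> (0 < s)%N ->
  q = (4 * (r * s)).+1 -> q = (p + 2 * s)%N -> (i.+1 < q)%N ->
  ((i.+1 * p) %/ q = i - i %/ (2 * r))%N.
Proof.
move=> r0 s0 qE pE iq; have r2 : (1 < 2 * r)%N by lia.
have := divn_eq i (2 * r); have := ltn_pmod i (ltnW r2); have := leq_div i (2 * r).
have: (i %/ (2 * r) < 2 * s)%N.
  by rewrite ltn_divLR ?(ltnW r2) //; move: (ltnW iq); nia.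
move: (i %/ _)%N (i %% _)%N => k j ks ki jr iE.
have si : (s * i = 2 * (k * (r * s)) + s * j)%N by rewrite iE; ring.
have sj : (s * j + s <= 2 * (r * s))%N 
  by rewrite -mulnSr (_ : 2 * (r * s) = s * (2 * r))%N ?leq_mul2l ?jr ?orbT //; ring.
have -> : (i.+1 * p = (i - k) * q + (4 * (r * s) + k.+1 - 2 * (s * j) - 2 * s))%N.
  have E1 : (i.+1 * p + 2 * (s * i) + 2 * s = i.+1 * q)%N by rewrite pE; ring.
  have E2 : (i.+1 * q = (i - k) * q + k.+1 * q)%N.
    by rewrite -mulnDl; congr (_ * _)%N; lia.
  have E3 : (k.+1 * q = 4 * (k * (r * s)) + 4 * (r * s) + k.+1)%N.
    by rewrite qE; ring.
  lia.
rewrite divnMDl ?divn_small ?addn0 //; lia.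
Qed.

Lemma odd_subS m k : (k < m)%N -> odd (m - k.+1) = ~~ odd (m + k).
Proof. by move=> km; rewrite oddB // oddD /=; case: odd; case: odd. Qed.

(* The two extra letters complete the word to [s] full periods. *)
Lemma knot_word_first r s p q : (0 < r)%N -> (0 < s)%N ->
  q.+1 = (4 * (r * s))%N -> q = (p + 2 * s)%N ->
  (gen_a, true) :: rcons (knot_word p q) (gen_b, true) =
  two_bridge_word [:: (gen_a, true); (gen_b, false)]
    [:: (gen_a, false); (gen_b, true)] r s.
Proof.
move=> r0 s0 qE pE; have q0 : (0 < q)%N by lia.
rewrite -[RHS](@map_iota_blocks _ (fun x y => (x, ~~ y))) // -mulnA -qE.
have -> : iota 0 q.+1 = 0%N :: iota 1 q.-1 ++ [:: q].
  rewrite [LHS]/=; congr (_ :: _).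
  by rewrite -[X in iota 1 X = _](prednK q0) -(addn1 q.-1) iotaD add1n prednK.
rewrite knot_wordE -cats1 map_cons map_cat; congr (_ :: _).
  by rewrite div0n.
have oq : odd q.
  by rewrite (_ : q = (2 * (r * s)).-1.*2.+1)%N ?oddS ?odd_double //; lia.
have ki i : (0 < i)%N -> (i %/ (2 * r) < i)%N by apply: ltn_Pdiv; lia.
(* The appended letter sits at index [q], the last one of the last half period, which fixes its
   sign. *)
have qdiv : (q %/ (2 * r) = (2 * s).-1)%N.
  rewrite (_ : q = (2 * s).-1 * (2 * r) + (2 * r).-1)%N; last first.
    have E : ((2 * s).-1.+1 * (2 * r) = 4 * (r * s))%N by rewrite prednK; [ring|lia].
    by move: E; rewrite mulSn; lia.
  by rewrite divnMDl ?divn_small ?addn0 //; lia.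
rewrite [X in _ = _ ++ X]/=; congr (_ ++ [:: (_, _)]).
- apply/eq_in_map => i; rewrite mem_iota => /andP[i0 iq].
  rewrite (divn_first r0 s0 qE pE) ?i0 /=; last by lia.
  by rewrite odd_subS ?ki.
- by rewrite oq.
- rewrite qdiv oddD oq (_ : (2 * s).-1 = (s.-1).*2.+1)%N ?oddS ?odd_double //.
  by lia.
Qed.

(** The [q - 1 = 4 r s] letters already form [s] full periods; numbering them from 1 instead of 0
    exchanges the roles of the two generators. *)
Lemma knot_word_second r s p q : (0 < r)%N -> (0 < s)%N ->
  q = (4 * (r * s)).+1 -> q = (p + 2 * s)%N ->
  knot_word p q =
  two_bridge_word [:: (gen_b, false); (gen_a, true)]
      [:: (gen_b, true); (gen_a, false)] r s.
Proof.
move=> r0 s0 qE pE; rewrite -[RHS](@map_iota_blocks _ (fun x y => (~~ x, y))) //.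
rewrite knot_wordE -mulnA {2}qE /= (iotaDl 1 0) -map_comp.
apply/eq_in_map => i; rewrite mem_iota => /andP[_ iq] /=.
rewrite (divn_second r0 s0 qE pE) ?qE //; congr (_, _).
by rewrite oddB ?leq_div // oddD.
Qed.

(** * Recovering [r] and [s] from a fraction of genus one *)

Lemma coprime_ratr_eq (p q p' q' : nat) : coprime p q -> coprime p' q' ->
  (0 < q)%N -> (0 < q')%N -> p%:R / q%:R = p'%:R / q'%:R :> rat -> p = p' /\ q = q'.
Proof.
move=> cpq cpq' q0 q0' /eqP.
rewrite eqr_div ?pnatr_eq0 -?lt0n // -!natrM eqr_nat => /eqP E.
have qq' : q = q'.
  apply/eqP; rewrite eqn_dvd -(@Gauss_dvdr q p q') 1?coprime_sym // E.
  by rewrite dvdn_mull //= -(@Gauss_dvdr q' p' q) 1?coprime_sym // -E dvdn_mull.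
split=> //; apply/eqP; move/eqP: E; rewrite qq' eqn_pmul2r //.
Qed.

(** A common divisor of [p] and [q] divides [2 s], hence [4 r s], which differs from [q] by one. *)
Lemma coprime_first r s p q : q = (p + 2 * s)%N ->
  q.+1 = (4 * (r * s))%N \/ q = (4 * (r * s)).+1 -> coprime p q.
Proof.
move=> pE qE; rewrite /coprime -dvdn1; set g := gcdn p q.
have gp : (g %| p)%N by apply: dvdn_gcdl.
have gq : (g %| q)%N by apply: dvdn_gcdr.
have g2 : (g %| 4 * (r * s))%N.
  have: (g %| 2 * s)%N by rewrite -(dvdn_addr _ gp) -pE.
  move=> /(dvdn_mull (2 * r)); congr (_ %| _)%N; ring.
case: qE => qE; first by rewrite -(dvdn_addr _ gq) addn1 qE.
by rewrite -(dvdn_addr _ g2) addn1 -qE.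
Qed.

(** Both fractions of the list are in lowest terms, as is [p / q], so numerators and denominators
    agree. *)
Lemma genus_oneP p q : coprime p q -> (0 < q)%N -> genus_one p q ->
  exists r s : nat, [/\ (0 < r)%N, (0 < s)%N, q = (p + 2 * s)%N &
    q.+1 = (4 * (r * s))%N \/ q = (4 * (r * s)).+1].
Proof.
move=> cpq q0 [r [s [r0 s0 E]]]; exists r, s.
(* This bound keeps the natural-number subtractions below from truncating. *)
have rs : (s <= r * s)%N by rewrite leq_pmull.
case: E => E.
- pose p' := (4 * (r * s) - 2 * s - 1)%N; pose q' := (4 * (r * s) - 1)%N.
  have pE : q' = (p' + 2 * s)%N by lia.
  have qE : q'.+1 = (4 * (r * s))%N by lia.
  have qR : q'%:R = 4 * r%:R * s%:R - 1 :> rat.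
    by have := congr1 (fun m => m%:R : rat) qE; rewrite -natr1 !natrM; lra.
  have pR : p'%:R = 4 * r%:R * s%:R - 2 * s%:R - 1 :> rat.
    by have := congr1 (fun m => m%:R : rat) pE; rewrite natrD natrM qR; lra.
  have [-> ->] : p = p' /\ q = q'.
    apply: coprime_ratr_eq; rewrite ?qR ?pR //; last lia.
    by apply: coprime_first pE _; left; exact: qE.
  by split=> //; left.
- pose p' := (4 * (r * s) - 2 * s).+1; pose q' := (4 * (r * s)).+1.
  have pE : q' = (p' + 2 * s)%N by lia.
  have qR : q'%:R = 4 * r%:R * s%:R + 1 :> rat.
    by rewrite /q' -(natr1 (4 * (r * s))%N) !natrM; lra.
  have pR : p'%:R = 4 * r%:R * s%:R - 2 * s%:R + 1 :> rat.
    by have := congr1 (fun m => m%:R : rat) pE; rewrite natrD natrM qR; lra.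
  have [-> ->] : p = p' /\ q = q'.
    apply: coprime_ratr_eq; rewrite ?qR ?pR //.
    by apply: coprime_first pE _; right.
  by split=> //; right.
Qed.

(** * The Alexander polynomial as a scalar Fox derivative *)

Section AlexanderPolynomial.
Variables (K : fieldType) (p q : nat).

(** With both generators sent to [t], each letter [a] contributes a difference of two consecutive
    powers [t ^ e i], while a letter [b] only moves the exponent. For odd [m] the last term of the
    alternating sum has no partner yet, and the correction removes it. *)
Lemma alexander_partial_sum (t : K) (m : nat) : t != 0 ->
  let M := fun _ : bool => t%:M : 'M[K]_1 in
  let w := [seq ((if odd i then gen_b else gen_a), eps p q i == -1)
             | i <- iota 1 m] in
  let e i := \sum_(1 <= j < i.+1) eps p q j in
  eval_word M w = (t ^ e m)%:M /\
  1 + (t%:M - 1) * eval_sum M (fox gen_a w) =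
  (\sum_(0 <= i < m.+1) (-1) ^+ i * t ^ e i + (odd m)%:R * t ^ e m)%:M.
Proof.
move=> t0 M w e; rewrite {}/w; elim: m => [|m [IHe IHs]].
  rewrite /e big_nat1 big_geq // expr0z !mulr1 /= addr0; split=> //.
  by rewrite /eval_sum big_nil mulr0 addr0.
rewrite -[in iota 1 m.+1](addn1 m) iotaD map_cat add1n [map _ (iota m.+1 1)]/=.
set l := [:: _].
have eS : e m.+1 = e m + eps p q m.+1 by rewrite /e big_nat_recr.
have epsE : eps p q m.+1 = if eps p q m.+1 == -1 then -1 else 1.
  by rewrite /eps -signr_odd; case: odd.
have evl : eval_word M l = (t ^ eps p q m.+1)%:M.
  rewrite /= mulmx1; case: ifP epsE => _ ->; rewrite ?expr1z //.
  by rewrite invmx_scalar exprN1.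
split.
  by rewrite eval_word_cat IHe evl eS expfzDr // scalar_mxM.
rewrite fox_cat mulrDr addrA IHs IHe [in RHS]big_nat_recr //= [in RHS]eS expfzDr //.
set z := t ^ e m; set s := \sum_(0 <= i < m.+1) _.
have -> : eval_sum M (fox gen_a l) =
   (if odd m then (if eps p q m.+1 == -1 then - t^-1 else 1) else 0)%:M.
  have -> : l = [:: (if odd m then gen_a else gen_b, eps p q m.+1 == -1)].
    by rewrite /l /=; case: odd.
  case: (odd m).
    by case: ifP => _; rewrite ?fox_gen // fox_gen_inv
      /M -[_^-1]/(invmx _) invmx_scalar raddfN.
  by rewrite fox_other // raddf0.
rewrite -[X in t%:M - X]/(1%:M) -raddfB -![_ * _%:M]scalar_mxM -raddfD; congr _%:M.
rewrite epsE exprS -signr_odd; case: (odd m); case: (eps p q m.+1 == -1);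
  by rewrite ?expr1z ?exprN1 /=; field.
Qed.

End AlexanderPolynomial.

Lemma alexander_fox (K : fieldType) (p q : nat) : odd q ->
  let M := fun _ : bool => (tvar K)%:M : 'M[ratfun K]_1 in
  1 + (M gen_a - 1) * eval_sum M (fox gen_a (knot_word p q)) =
  (alexander K p q)%:M.
Proof.
move=> q_odd M; have t0 : tvar K != 0 by rewrite tofrac_eq0 polyX_eq0.
have [_ E] := alexander_partial_sum p q q.-1 t0.
rewrite [LHS]E prednK ?odd_gt0 //; congr _%:M.
by rewrite (_ : odd q.-1 = false) ?mul0r ?addr0 //; case: (q) q_odd => //= m /negbTE.
Qed.

(** * Geometric sums and the determinants of the two families *)

Section GeometricSums.
Variables (R : pzRingType) (z : R).

Lemma sum_exprD i j :
  \sum_(h < i + j) z ^+ h = \sum_(h < i) z ^+ h + z ^+ i * \sum_(h < j) z ^+ h.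
Proof.
rewrite big_split_ord mulr_sumr; congr (_ + _).
by apply: eq_bigr => h _; rewrite -exprD.
Qed.

(** The factor [1 + z^r] extends [r] consecutive powers to [2 r], the translates by multiples of
    [2 r] fill up [2 r s], and the last factor doubles this to [4 r s]. *)
Lemma geometric_product r s :
  (\sum_(i < s) z ^+ (2 * r * i)) * (\sum_(i < r) z ^+ i) *
  ((1 + z ^+ r) * (1 + z ^+ (2 * (r * s))%N)) = \sum_(i < 4 * (r * s)) z ^+ i.
Proof.
have double m : (\sum_(i < m) z ^+ i) * (1 + z ^+ m) = \sum_(i < 2 * m) z ^+ i.
  by rewrite mul2n -addnn sum_exprD mulrDr mulr1 sum_expr_comm.
have blocks : (\sum_(i < s) z ^+ (2 * r * i)) * (\sum_(i < 2 * r) z ^+ i) =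
    \sum_(i < 2 * r * s) z ^+ i.
  elim: (s) => [|m IHm]; first by rewrite big_ord0 mul0r muln0 big_ord0.
  by rewrite big_ord_recr /= mulrDl IHm mulnSr [RHS]sum_exprD.
rewrite mulrA -(mulrA _ _ (1 + z ^+ r)) double blocks -mulnA double.
by rewrite mulnA.
Qed.

Lemma geometric_comm r s m :
  GRing.comm ((\sum_(i < s) z ^+ (2 * r * i)) * (\sum_(i < r) z ^+ i)) (1 + z ^+ m).
Proof.
apply/commr_sym/commrM; apply/commr_sum => i _; apply/commrX/commr_sym/commrD.
- exact: commr1.
- exact/commrX.
- exact: commr1.
- exact/commrX.
Qed.

End GeometricSums.

Lemma coprime_factors m r s : coprime m (4 * (r * s))%N ->
  coprime m r /\ coprime m (2 * (r * s))%N.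
Proof.
rewrite -[4%N]/(2 * 2)%N -mulnA coprimeMr => /andP[_ cm]; split=> //.
by move: cm; rewrite !coprimeMr => /and3P[].
Qed.

Section TwoBridgeDeterminant.
Variables (K : fieldType) (n : nat) (r s p q : nat) (z : bool -> 'I_n.+2) (t : K).
Hypothesis n_odd : odd n.
Hypothesis l0 : n.+2%:R != 0 :> K.
Hypothesis two0 : 2%:R != 0 :> K.
Hypotheses (r0 : (0 < r)%N) (s0 : (0 < s)%N) (pE : q = (p + 2 * s)%N).
Hypothesis l_dvd_q : (n.+2 %| q)%N.
Hypotheses (t0 : t != 0) (t1 : t != 1) (tN1 : t != -1).

Local Notation J := (ones K n).
Local Notation rot := (@rot K n).
Local Notation refl := (@refl K n).
Local Notation c := ((r * s)%N%:R : K).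

Let k := z gen_a - z gen_b.
Hypothesis ku : k \is a GRing.unit.

Let M (b : bool) : 'M[K]_n.+2 := t *: refl (z b).

Lemma M_unit b : M b \is a GRing.unit.
Proof. by rewrite /M scaler_unit ?unitfE // refl_unit. Qed.

Lemma MV b : (M b)^-1 = t^-1 *: refl (z b).
Proof. by rewrite invrZ ?unitfE ?refl_unit // reflV. Qed.

Lemma unit_mulrn u m : u \is a GRing.unit -> coprime n.+2 m ->
  (u *+ m : 'I_n.+2) \is a GRing.unit.
Proof.
move=> uu cm; rewrite -mulr_natr unitrM uu.
by rewrite (@unitZpE n.+2 m).
Qed.

(** The [q] powers run [q / l] times through the cyclic group. *)
Lemma sum_rot_full u : u \is a GRing.unit ->
  \sum_(i < q) rot u ^+ i = (q %/ n.+2)%:R *: J.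
Proof.
move=> uu; rewrite -[in LHS](divnK l_dvd_q); elim: (q %/ _)%N => [|m IHm].
  by rewrite big_ord0 scale0r.
rewrite mulSn sum_exprD IHm rotX.
have -> : u *+ n.+2 = 0 by rewrite -mulr_natr (@pchar_Zp n.+2) ?mulr0.
rewrite rot0 mul1r (eq_bigr (fun i : 'I_n.+2 => rot (u *+ i))); last first.
  by move=> i _; rewrite rotX.
by rewrite sum_rot // -natr1 scalerDl scale1r addrC.
Qed.

(** The sum of [4 r s = q + 1] powers is the identity plus [q / l] copies of [ones], so [j = q / l].
    The outer factor [t A] cancels the power [t^-l]. *)
Lemma det_two_bridge_first : q.+1 = (4 * (r * s))%N ->
  \det (1 + (M gen_a - 1) * eval_sum M (fox gen_a (knot_word p q))) ^+ 2 =
  ((t + c * (t - 1) ^+ 2) * (1 - t ^+ 2) ^+ n.+1) ^+ 2.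
Proof.
move=> qE.
have [cr cy] : coprime n.+2 r /\ coprime n.+2 (2 * (r * s))%N.
  have : coprime n.+2 (4 * (r * s))%N by rewrite -qE (coprime_dvdl l_dvd_q) ?coprimenS.
  by apply: coprime_factors.
have S1 : (M gen_a)^-1 * M gen_b = rot k.
  by rewrite MV -scalerAl -scalerAr scalerA mulVf // scale1r reflM.
have S2 : M gen_a * (M gen_b)^-1 = rot k.
  by rewrite MV -scalerAl -scalerAr scalerA mulfV // scale1r reflM.
rewrite (fox_word_first (M_unit _) S1 S2 (knot_word_first r0 s0 qE pE)).
rewrite MV rotX [\det _]det_mulmx exprMn.
set P := _ * \sum_(i < r) _.
rewrite (@det_dihedral_sqr _ _ n_odd l0 two0 _ (k *+ r) (k *+ (2 * (r * s))%N) _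
  (q %/ n.+2)%:R c) ?unit_mulrn //.
- rewrite detZ exprMn det_refl_sqr mulr1 -exprMn; congr (_ ^+ 2).
  by rewrite !mulrA divff ?expf_neq0 // mul1r.
- rewrite -!rotX -[LHS]mulrA -[_ * P]geometric_comm mulrA.
  rewrite -[_ * P]geometric_comm -[LHS]mulrA geometric_product -qE.
  rewrite (sum_exprD _ 1) big_ord1 expr0 sum_rot_full // -scalerAr.
  by rewrite expr1 rot_ones.
- by rewrite -natrM mulnC divnK // -natrM -qE -natr1 addrK.
Qed.

Lemma det_two_bridge_second : q = (4 * (r * s)).+1 ->
  \det (1 + (M gen_a - 1) * eval_sum M (fox gen_a (knot_word p q))) ^+ 2 =
  (t ^- n.+2 * (t - c * (t - 1) ^+ 2) * (1 - t ^+ 2) ^+ n.+1) ^+ 2.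
Proof.
move=> qE.
have [cr cy] : coprime n.+2 r /\ coprime n.+2 (2 * (r * s))%N.
  have : coprime n.+2 (4 * (r * s))%N by rewrite (coprime_dvdl l_dvd_q) ?qE ?coprimeSn.
  by apply: coprime_factors.
have T1 : M gen_b * (M gen_a)^-1 = rot (- k).
  by rewrite MV -scalerAl -scalerAr scalerA mulfV // scale1r reflM opprB.
have T2 : (M gen_b)^-1 * M gen_a = rot (- k).
  by rewrite MV -scalerAl -scalerAr scalerA mulVf // scale1r reflM opprB.
rewrite (fox_word_second T1 T2 (knot_word_second r0 s0 qE pE)).
set P := _ * \sum_(i < r) _.
have TV m : rot (- k) ^+ m * rot (k *+ m) = 1.
  by rewrite rotX rotM mulNrn addNr rot0.
rewrite -(mulNr c).
(* Taking out [- rot (- k) ^+ r.+1] gives the required shape, because [rot (- k)] carries the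
   reflection of [a] to that of [b]. The sign turns [c] and [j] into [- r s] and [- q / l]. *)
rewrite -(@det_dihedral_sqr _ _ n_odd l0 two0 (z gen_a) (k *+ r)
  (- k *+ (2 * (r * s))%N) (- (P * rot (- k) ^+ r.+1)) (- (q %/ n.+2)%:R))
  ?unit_mulrn ?unitrN //.
- congr (\det (1 + _) ^+ 2); rewrite -[RHS]mulrA MV; congr (_ * _).
  rewrite mulNr -mulrN [- (_ - t^-1 *: _)]opprB -[RHS]mulrA; congr (_ * _).
  rewrite mulrBr -!scalerAr exprSr -!mulrA rot_refl.
  have -> : - k + z gen_a = z gen_b by rewrite /k; ring.
  congr (_ - _).
  by rewrite mulrA -exprSr exprS -mulrA TV mulr1.
(* [V] is the inverse of [rot (- k) ^+ r]; through it both factors are expressed by the single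
   rotation [rot (- k)], as the geometric product demands. *)
- pose V := rot (k *+ r); have VT : V * rot (- k) ^+ r = 1.
    by rewrite rotX rotM mulNrn subrr rot0.
  rewrite -/V -(rotX _ _ (2 * _)).
  have -> : 1 + V = V * (1 + rot (- k) ^+ r) by rewrite mulrDr mulr1 VT addrC.
  have HP : V * (1 + rot (- k) ^+ r) * (1 + rot (- k) ^+ (2 * (r * s))%N) * P =
      V * \sum_(i < 4 * (r * s)) rot (- k) ^+ i.
    rewrite -[LHS]mulrA -[_ * P]geometric_comm mulrA.
    rewrite -[V * _ * P]mulrA -[_ * P]geometric_comm -(mulrA V) -(mulrA P).
    by rewrite geometric_product.
  rewrite mulrN mulrA HP -mulrA sum_expr_comm exprSr !mulrA VT mul1r.
  have := sum_rot_full; rewrite qE => /(_ (- k)).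
  rewrite unitrN => /(_ ku); rewrite (sum_exprD _ 1) big_ord1 expr0 expr1 => E.
  by rewrite scaleNr -E [- (1 + _)]opprD addrA subrr sub0r.
- by rewrite mulrN -natrM mulnC divnK // mulrN -natrM -opprD natr1 qE.
Qed.
End TwoBridgeDeterminant.

(** * Closed form of the Alexander polynomial *)

Section ScalarEvaluation.
Variables (F : fieldType) (r s p q : nat) (t : F).
Hypotheses (r0 : (0 < r)%N) (s0 : (0 < s)%N) (pE : q = (p + 2 * s)%N).
Hypothesis t0 : t != 0.
Local Notation c := ((r * s)%N%:R : F).

Let M (b : bool) : 'M[F]_1 := t%:M.

Lemma sum_expr1n (R : pzRingType) m (f : nat -> nat) :
  \sum_(i < m) (1 : R) ^+ f i = m%:R.
Proof. by under eq_bigr do rewrite expr1n; rewrite sumr_const card_ord. Qed.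

Lemma scalar_unit (x : F) : x != 0 -> (x%:M : 'M_1) \is a GRing.unit.
Proof. by move=> x0; rewrite [_ \is a _]unitmxE det_scalar1 unitfE. Qed.

Lemma scalar_inv (x : F) : (x%:M : 'M_1)^-1 = x^-1%:M.
Proof. exact: invmx_scalar. Qed.

Lemma natr_scalar m : (m%:R : 'M[F]_1) = (m%:R : F)%:M.
Proof. by rewrite raddfMn. Qed.

Lemma scalarE :
  (forall x y : F, (x%:M : 'M_1) * y%:M = (x * y)%:M) *
  (forall x : F, (x%:M : 'M_1) - 1 = (x - 1)%:M) *
  (forall x : F, 1 - (x%:M : 'M_1) = (1 - x)%:M) *
  (forall x : F, 1 + (x%:M : 'M_1) = (1 + x)%:M).
Proof.
split; [split; [split|]|] => x; first by move=> y; rewrite scalar_mxM.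
- by rewrite raddfB.
- by rewrite raddfB.
- by rewrite raddfD.
Qed.

Let Mu b : M b \is a GRing.unit := scalar_unit t0.

(** In the scalar case [S] becomes 1, and the two geometric sums become [s] and [r]. *)
Lemma scalar_first : q.+1 = (4 * (r * s))%N ->
  1 + (M gen_a - 1) * eval_sum M (fox gen_a (knot_word p q)) =
  (t + c * (t - 1) ^+ 2)%:M.
Proof.
move=> qE.
rewrite (fox_word_first (Mu gen_a) (mulVr (Mu gen_b)) (mulrV (Mu gen_b))
  (knot_word_first r0 s0 qE pE)).
rewrite /M sum_expr1n (sum_expr1n _ _ id) expr1n scalar_inv !natr_scalar !scalarE.
by congr _%:M; rewrite natrM; field; exact: t0.
Qed.

Lemma scalar_second : q = (4 * (r * s)).+1 ->
  1 + (M gen_a - 1) * eval_sum M (fox gen_a (knot_word p q)) =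
  (t^-1 * (t - c * (t - 1) ^+ 2))%:M.
Proof.
move=> qE.
rewrite (fox_word_second (mulrV (Mu gen_b)) (mulVr (Mu gen_b))
  (knot_word_second r0 s0 qE pE)).
rewrite /M sum_expr1n (sum_expr1n _ _ id) expr1n mul1r scalar_inv !natr_scalar !scalarE.
by congr _%:M; rewrite natrM; field; exact: t0.
Qed.

End ScalarEvaluation.

Lemma tvar_neq0 (K : fieldType) : tvar K != 0.
Proof. by rewrite tofrac_eq0 polyX_eq0. Qed.

Lemma scalar_inj (F : fieldType) : injective (@scalar_mx F 1).
Proof. by move=> x y /(congr1 (fun A : 'M_1 => A 0 0)); rewrite !mxE. Qed.

Lemma alexander_first (K : fieldType) r s p q :
  (0 < r)%N -> (0 < s)%N -> q = (p + 2 * s)%N -> q.+1 = (4 * (r * s))%N ->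
  alexander K p q = tvar K + (r * s)%N%:R * (tvar K - 1) ^+ 2.
Proof.
move=> r0 s0 pE qE; have q_odd : odd q by rewrite -[odd q]negbK -oddS qE oddM.
apply: scalar_inj; rewrite -(alexander_fox K p q_odd).
exact: (scalar_first r0 s0 pE (tvar_neq0 K) qE).
Qed.

Lemma alexander_second (K : fieldType) r s p q :
  (0 < r)%N -> (0 < s)%N -> q = (p + 2 * s)%N -> q = (4 * (r * s)).+1 ->
  alexander K p q =
  (tvar K)^-1 * (tvar K - (r * s)%N%:R * (tvar K - 1) ^+ 2).
Proof.
move=> r0 s0 pE qE; have q_odd : odd q by rewrite qE oddS oddM.
apply: scalar_inj; rewrite -(alexander_fox K p q_odd).
exact: (scalar_second r0 s0 pE (tvar_neq0 K) qE).
Qed.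

(** * Homomorphisms of the knot group onto the dihedral group *)

Lemma pres_ind (X : choiceType) (rels : seq (word X * word X))
    (Q : presented rels -> Prop) :
  Q 1%g -> (forall g h, Q g -> Q h -> Q (g * h)%g) ->
  (forall x, Q (pres_gen rels x) /\ Q (pres_gen rels x)^-1%g) ->
  forall g, Q g.
Proof.
move=> Q1 QM Qgen g; rewrite -(pres_classK g).
elim: (repr g) => [|l w IHw]; first exact: Q1.
have -> : pres_class rels (l :: w) = (pres_class rels [:: l] * pres_class rels w)%g.
  by rewrite -[RHS]/(pres_mul _ _) pres_mulE.
apply: QM IHw; case: l => x [].
  suff -> : pres_class rels [:: (x, true)] = (pres_gen rels x)^-1%g by case: (Qgen x).
  apply: (mulgI (pres_gen rels x)); rewrite mulgV.
  rewrite -[LHS]/(pres_mul _ _) pres_mulE; apply/pres_classP.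
  exact: (pres_cancel rels (x, false)).
by case: (Qgen x).
Qed.

Lemma representationV (K : fieldType) (G : groupType) n (F : G -> 'M[K]_n.+1) g :
  is_representation F -> F g^-1%g = (F g)^-1.
Proof.
move=> [F1 FM]; have E : F g * F g^-1%g = 1 by rewrite -[LHS]FM mulgV.
have u : F g \is a GRing.unit.
  by apply/unitrP; exists (F g^-1%g); rewrite -[_ * F g]FM mulVg.
by rewrite -[LHS](mulKr u) E mulr1.
Qed.

Section DihedralRepresentation.
Variables (K : fieldType) (n : nat).
Hypothesis u2 : (2%:R : 'I_n.+2) \is a GRing.unit.
Hypothesis l_prime : prime n.+2.

Local Notation rot := (@rot K n).
Local Notation refl := (@refl K n).

Definition is_rot (A : 'M[K]_n.+2) : Prop := exists u, A = rot u.
Definition is_refl (A : 'M[K]_n.+2) : Prop := exists u, A = refl u.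

Lemma refl_inj : injective refl.
Proof.
move=> a b /(congr1 (fun A : 'M_n.+2 => A a 0)); rewrite !mxE !addr0 eqxx.
by case: eqP => // _ /eqP; rewrite oner_eq0.
Qed.

(** A rotation commutes with [rot 1]; for a reflection this would force 2 = 0 in Z/l, where 2 is a
    unit. *)
Lemma rot_neq_refl a b : rot a <> refl b.
Proof.
move=> E; have : rot 1 * rot a = rot a * rot 1 by rewrite !rotM addrC.
rewrite E rot_refl refl_rot => /refl_inj /(congr1 (fun x => x - b + 1)).
rewrite addrK -addrA [- b + 1]addrC addrA subrK subrr => E2.
by move: u2; rewrite mulr2n E2 unitr0.
Qed.

Lemma is_rot_refl A : is_rot A -> is_refl A -> False.
Proof. by move=> [u ->] [v]; apply: rot_neq_refl. Qed.

Lemma rot_or_reflM A B : is_rot A \/ is_refl A -> is_rot B \/ is_refl B ->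
  is_rot (A * B) \/ is_refl (A * B).
Proof.
by move=> [[u ->]|[u ->]] [[v ->]|[v ->]];
  rewrite ?rotM ?reflM ?rot_refl ?refl_rot; [left|right|right|left]; eexists.
Qed.

Lemma shift_mxE : shift_mx K n.+2 = rot 1.
Proof.
apply/matrixP => i j; rewrite !mxE; congr (_%:R); congr nat_of_bool.
rewrite -(inj_eq val_inj) /= (@modn_small 1) // addn1.
have := ltn_ord j; rewrite ltnS leq_eqVlt => /orP[/eqP ->|jn].
  by rewrite modnn eqxx andbT [i == n.+2 :> nat]ltn_eqF ?orbF.
by rewrite modn_small // [j == _ :> nat]ltn_eqF // andbF.
Qed.

Lemma antidiag_mxE : antidiag_mx K n.+2 = refl (- 1).
Proof.
apply/matrixP => i j; rewrite !mxE; congr (_%:R); congr nat_of_bool.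
rewrite -(inj_eq val_inj) /= (@modn_small 1) // subn1 /= (@modn_small n.+1) //.
case: (ltnP (i + j) n.+2) => ij; first by rewrite (modn_small ij).
(* A sum [i + j >= l] reduces to at most [l - 2], so wrapping around creates no further ones. *)
rewrite -(subnK ij) modnDr modn_small; last first.
  by have := ltn_ord i; have := ltn_ord j; lia.
by have := ltn_ord i; have := ltn_ord j; move: ij; lia.
Qed.

Variable f : dihedral n.+2 -> 'M[K]_n.+2.
Hypothesis fP : is_pi f.

Lemma pi_rot_or_refl d : is_rot (f d) \/ is_refl (f d).
Proof.
case: fP => frep fx fy; have [f1 fM] := frep.
elim/pres_ind: d => [|g h IHg IHh|x].
- by left; exists 0; rewrite rot0 f1.
- by rewrite fM; apply: rot_or_reflM.
- rewrite (representationV _ frep); case: x.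
  + rewrite [f _]fy shift_mxE rotV; split; left; eexists; reflexivity.
  + rewrite [f _]fx antidiag_mxE reflV; split; right; eexists; reflexivity.
Qed.

Variables (p q : nat) (rho : {multiplicative knot_group p q -> dihedral n.+2}).
Hypothesis rho_surj : forall d, exists g, rho g = d.
Let phi g := f (rho g).

Lemma phi_representation : is_representation phi.
Proof.
case: fP => -[f1 fM] _ _; split=> [|g h]; rewrite /phi.
  rewrite (_ : rho 1%g = 1%g) //; apply: (mulgI (rho 1%g)).
  by rewrite -gmulfM !mulg1.
by rewrite gmulfM fM.
Qed.

Lemma knot_relation (w := pres_class _ (knot_word p q) : knot_group p q) :
  (pres_gen _ gen_a * w = w * pres_gen _ gen_b)%g.
Proof.
rewrite -[LHS]/(pres_mul _ _) -[RHS]/(pres_mul _ _) !pres_mulE.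
apply/pres_classP; rewrite cats1.
by apply: (@pres_rel _ _ (_, _)); rewrite inE.
Qed.

(** The relation [a w = w b] makes [A] and [B] both rotations or both reflections. If both were
    rotations, the image would miss [x]; if they were equal reflections, it would miss [y]. As l is
    prime, the nonzero difference is a unit. *)
Lemma phi_gen : exists2 z : bool -> 'I_n.+2,
  (forall b, phi (pres_gen _ b) = refl (z b)) & z gen_a - z gen_b \is a GRing.unit.
Proof.
have [phi1 phiM] := phi_representation; have [_ fx fy] := fP.
have phiV g := representationV g phi_representation.
have phiRF g : is_rot (phi g) \/ is_refl (phi g) by apply: pi_rot_or_refl.
set A := phi (pres_gen _ gen_a); set B := phi (pres_gen _ gen_b).
have [W rW AW] : exists2 W, is_rot W \/ is_refl W & A * W = W * B.
  by exists (phi (pres_class _ (knot_word p q))); rewrite -?[_ * _]phiM ?knot_relation.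
have rotA : is_rot A -> False.
  move=> rA; have rB : is_rot B.
    case: (phiRF (pres_gen _ gen_b)) => // -[b]; rewrite -/B => Bb.
    case: rA AW => a -> ; rewrite Bb; case: rW => [[w ->]|[w ->]].
      by rewrite rotM rot_refl => /rot_neq_refl.
    by rewrite rot_refl reflM => /esym/rot_neq_refl.
  have rphi g : is_rot (phi g).
    elim/pres_ind: g => [|g h|x].
    - by exists 0; rewrite phi1 rot0.
    - by rewrite phiM => -[u ->] [v ->]; exists (u + v); rewrite -rotM.
    - rewrite phiV; suff [u ->] : is_rot (phi (pres_gen _ x)).
        by split; [exists u|exists (- u); rewrite rotV].
      by case: x.
  have [g gx] := rho_surj (dih_x n.+2).
  apply: (is_rot_refl (rphi g)); exists (- 1).
  by rewrite /phi gx fx antidiag_mxE.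
have [//|[a Aa]] := phiRF (pres_gen _ gen_a).
have [b Bb] : is_refl B.
  have [[u Bu]|//] := phiRF (pres_gen _ gen_b); move: AW; rewrite /A Aa /B Bu.
  case: rW => [[w ->]|[w ->]].
    by rewrite refl_rot rotM => /esym/rot_neq_refl.
  by rewrite reflM refl_rot => /rot_neq_refl.
exists (fun x => if x then b else a); first by case.
have ab : a - b != 0.
  apply/eqP => /subr0_eq ab.
  have phiA g : phi g = 1 \/ phi g = A.
    elim/pres_ind: g => [|g h|x].
    - by left; rewrite phi1.
    - rewrite phiM /A Aa => -[->|->] [->|->]; rewrite ?[_ *m _]mul1r ?[_ *m _]mulr1;
        [left|right|right|left] => //; exact: refl_sqr.
    - rewrite phiV; have -> : phi (pres_gen _ x) = A.
        by case: x; rewrite // -/B Bb /A Aa ab.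
      by rewrite /A Aa reflV; split; right.
  have [g gy] := rho_surj (dih_y n.+2).
  have : phi g = rot 1 by rewrite /phi gy fy shift_mxE.
  case: (phiA g) => ->; last by rewrite /A Aa => /esym/rot_neq_refl.
  rewrite -rot0 => /(congr1 (fun M : 'M_n.+2 => M 0 0)).
  by rewrite !mxE !add0r eqxx => /eqP; rewrite oner_eq0.
rewrite -[_ - _]natr_Zp (@unitZpE n.+2) // prime_coprime //.
rewrite gtnNdvd ?ltn_ord // lt0n.
by apply: contra ab => /eqP E; apply/eqP/val_inj.
Qed.

End DihedralRepresentation.

(** * Integer Laurent polynomials and the congruence modulo l *)

Definition laurent_of_poly (P : {poly int}) : int_laurent :=
  [fsfun k in [fset Posz (nat_of_ord i) | i in 'I_(size P)]%fset =>
     if k is Posz i then P`_i else 0 | 0].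

Lemma laurent_of_polyE (P : {poly int}) k :
  laurent_of_poly P k = if k is Posz i then P`_i else 0.
Proof.
rewrite fsfunE; case: ifP => // /negbT; case: k => // i.
case: (ltnP i (size P)) => iP; last by rewrite nth_default.
by case/imfsetP; exists (Ordinal iP).
Qed.

Lemma laurent_at_poly (F : fieldType) (P : {poly int}) (z : F) :
  laurent_at (laurent_of_poly P) z = (map_poly intr P).[z].
Proof.
rewrite /laurent_at (big_fset_incl _ (finsupp_sub _ _ _)); last first.
  by move=> k _; rewrite memNfinsupp => /eqP ->; rewrite mul0r.
rewrite big_imfset /=; last by move=> i j _ _ [] /val_inj.
rewrite big_enum /= (@horner_coef_wide _ (size P)); last exact: size_poly.
by apply: eq_bigr => i _; rewrite laurent_of_polyE coef_map.
Qed.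

Lemma genus_one_congr (l m : nat) (c : int) : prime l -> l = m.*2.+1 ->
  (l%:Z %| 4 * c - 1)%Z ->
  exists H : {poly int},
    ('X + 1) ^+ m * (1 + 'X) ^+ m - ('X + c%:P * ('X - 1) ^+ 2) ^+ m = l%:R * H.
Proof.
move=> l_prime lE /dvdzP[e eE].
pose D : {poly int} := 'X + c%:P * ('X - 1) ^+ 2.
have D4 : 4 * D - ('X + 1) ^+ 2 = l%:R * (e%:P * ('X - 1) ^+ 2).
  transitivity ((4 * c%:P - 1) * ('X - 1) ^+ 2 : {poly int}); first by rewrite /D; ring.
  have -> : 4 * c%:P - 1 = (4 * c - 1)%:P :> {poly int}.
    by rewrite polyCB polyCM polyC_natr.
  by rewrite eE polyCM -[l%:Z]natz polyC_natr mulrA [l%:R * _]mulrC.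
have [k kE] : exists k, (4 ^ m = 1 + l * k)%N.
  (* Fermat's theorem gives [2^l = 2] modulo [l]; since [l] is odd, dividing by 2 yields
     [4^m = 1]. *)
  have /eqP := fermat_little 2 l_prime.
  rewrite {1}lE expnS -mul2n expnM eqn_mod_dvd; last first.
    by rewrite -{1}[2%N]muln1 leq_mul2l expn_gt0.
  have -> : (2 * (2 ^ 2) ^ m - 2 = 2 * (4 ^ m - 1))%N by rewrite mulnBr muln1.
  rewrite Gauss_dvdr; last first.
    by rewrite lE coprimen2 /= odd_double.
  by move=> /dvdnP[k kE]; exists k; rewrite mulnC -kE addnC subnK ?expn_gt0.
(* The first term comes from [4^m - 1 = l k], the second from dividing [(4 D)^m - (X + 1)^(2 m)] by
   [4 D - (X + 1)^2]. *)
exists (k%:R * D ^+ m - (e%:P * ('X - 1) ^+ 2) *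
  \sum_(i < m) (4 * D) ^+ (m.-1 - i) * (('X + 1) ^+ 2) ^+ i).
set Sg := \sum_(i < m) _.
transitivity ((l * k)%N%:R * D ^+ m - (4 * D - ('X + 1) ^+ 2) * Sg); last first.
  by rewrite D4 natrM; move: e%:P Sg => E Sg; ring.
rewrite -subrXX exprMn.
have -> : 4 ^+ m = 1 + (l * k)%N%:R :> {poly int} by rewrite -natrX kE natrD.
rewrite -exprM mul2n -addnn exprD -/D [1 + 'X]addrC.
by move: (D ^+ m) (('X + 1) ^+ m) => X Y; ring.
Qed.

(** * The twisted polynomial up to units *)

Lemma sqr_signed (F : fieldType) (x y : F) : x ^+ 2 = y ^+ 2 ->
  exists e : bool, x = (-1) ^+ e * y.
Proof.
move/eqP; rewrite eqf_sqr => /orP[] /eqP ->; first by exists false; rewrite mul1r.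
by exists true; rewrite mulN1r.
Qed.

Lemma tvar_neq_const (K : fieldType) (c : K) : tvar K != const_rf c.
Proof.
rewrite tofrac_eq; apply/eqP => /(congr1 (fun P : {poly K} => P`_1)).
by rewrite coefX coefC /= => /eqP; rewrite oner_eq0.
Qed.

Lemma const_rf_nat (K : fieldType) m : const_rf (m%:R : K) = m%:R.
Proof. by rewrite /const_rf polyC_natr rmorph_nat. Qed.

Lemma sub_sqr_neq0 (F : fieldType) (x : F) : x != 1 -> x != -1 -> 1 - x ^+ 2 != 0.
Proof. by move=> x1 xN1; rewrite subr_eq0 eq_sym sqrf_eq1 negb_or x1. Qed.

(** Numerator [N] and denominator [E] are known only through their squares, which leaves the sign
    open; [u] stands for a power of [t]. *)
Lemma quotient_square (F : fieldType) (x D W u N E : F) :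
  x != 0 -> W != 0 -> u != 0 ->
  N ^+ 2 = (u^-1 * D * W ^+ 2) ^+ 2 -> E ^+ 2 = (x * W) ^+ 2 ->
  exists e : bool, D / x * W = (-1) ^+ e * (u * (N / E)).
Proof.
move=> x0 W0 u0 NE EE; apply: sqr_signed.
rewrite [RHS]exprMn [(N / E) ^+ 2]exprMn [E^-1 ^+ 2]exprVn NE EE.
by field; rewrite x0 W0 u0.
Qed.

Section TwistedPolynomial.
Variables (K : fieldType) (p q n : nat) (phi : knot_group p q -> 'M[K]_n.+2).
Variable z : bool -> 'I_n.+2.
Hypothesis phiE : forall b, phi (pres_gen _ b) = refl K (z b).
Hypotheses (n_odd : odd n) (l0 : n.+2%:R != 0 :> K).
Local Notation t := (tvar K).

Lemma t_phiE : t_phi phi = fun b => t *: refl (ratfun K) (z b).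
Proof.
apply/funext => b; rewrite /t_phi phiE; congr (_ *: _).
by apply/matrixP => i j; rewrite !mxE const_rf_nat.
Qed.

Lemma tvar_neq1 : t != 1.
Proof.
have -> : 1 = const_rf (1 : K) :> ratfun K by rewrite /const_rf rmorph1.
exact: tvar_neq_const.
Qed.

Lemma tvar_neqN1 : t != -1.
Proof.
have -> : -1 = const_rf (-1 : K) by rewrite /const_rf polyCN rmorphN rmorph1.
exact: tvar_neq_const.
Qed.

Lemma ratfun_natr_neq0 m : m%:R != 0 :> K -> m%:R != 0 :> ratfun K.
Proof. by move=> m0; rewrite -const_rf_nat tofrac_eq0 polyC_eq0. Qed.

Lemma twisted_denominator :
  \det (t_phi phi gen_b - 1%:M) ^+ 2 = ((t - 1) * (1 - t ^+ 2) ^+ (n.+1)./2) ^+ 2.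
Proof.
rewrite t_phiE.
have -> : t *: refl (ratfun K) (z gen_b) - 1%:M =
    - (1 + (- t) *: refl (ratfun K) (z gen_b)).
  by rewrite opprD scaleNr opprK addrC.
rewrite -scaleN1r detZ exprMn sqrr_sign mul1r.
rewrite det_add_refl_sqr ?ratfun_natr_neq0 // ?eqr_oppLR ?tvar_neqN1 //.
by rewrite sqrrN; move: (_ ^+ (n.+1)./2) => X; ring.
Qed.

(** [k] absorbs the power [t^(k l)] by which the numerator is off: 0 for [q = 4 r s - 1] and 1 for
    [q = 4 r s + 1]. *)
Lemma twisted_equal_up_to (k : int) (D : ratfun K) :
  \det (1 + (t *: refl (ratfun K) (z gen_a) - 1) *
    eval_sum (fun b => t *: refl (ratfun K) (z b)) (fox gen_a (knot_word p q))) ^+ 2 =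
  (t ^ (- (k * n.+2%:Z)) * D * (1 - t ^+ 2) ^+ n.+1) ^+ 2 ->
  equal_up_to n.+2 (D / (t - 1) * (1 - t ^+ 2) ^+ (n.+1)./2) (twisted_alexander phi).
Proof.
have t1 : t - 1 != 0 by rewrite subr_eq0 tvar_neq1.
have tt := expf_neq0 (n.+1)./2 (sub_sqr_neq0 tvar_neq1 tvar_neqN1).
have nE : ((n.+1)./2 * 2)%N = n.+1 by rewrite muln2 even_halfK //= n_odd.
rewrite -[in (1 - t ^+ 2) ^+ _]nE exprM => numE; have := twisted_denominator.
rewrite /twisted_alexander /A_hat t_phiE -[1%:M]/1 in numE *.
rewrite -[X in \det X / _]/(1 + (t *: refl (ratfun K) (z gen_a) - 1) *
    eval_sum (fun b => t *: refl (ratfun K) (z b)) (fox gen_a (knot_word p q))).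
move: numE; move: (\det _) (\det _) (_ ^+ (n.+1)./2) tt => E N W W0 NE EE.
have tk0 : t ^ (k * n.+2%:Z) != 0 by rewrite expfz_neq0 ?tvar_neq0.
rewrite -invr_expz in NE.
have [e ->] := quotient_square t1 W0 tk0 NE EE.
by exists e, k; rewrite [LHS]mulrA.
Qed.
End TwistedPolynomial.

Lemma horner_intr (F : fieldType) (x : F) :
  ((map_poly intr 'X : {poly F}).[x] = x) *
  (forall c : int, (map_poly intr c%:P : {poly F}).[x] = c%:~R) *
  ((map_poly intr 1 : {poly F}).[x] = 1) *
  (forall P Q : {poly int}, (map_poly intr (P + Q) : {poly F}).[x] =
    (map_poly intr P).[x] + (map_poly intr Q).[x]) *
  (forall P Q : {poly int}, (map_poly intr (P * Q) : {poly F}).[x] =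
    (map_poly intr P).[x] * (map_poly intr Q).[x]) *
  (forall P : {poly int}, (map_poly intr (- P) : {poly F}).[x] =
    - (map_poly intr P).[x]) *
  (forall (P : {poly int}) m, (map_poly intr (P ^+ m) : {poly F}).[x] =
    (map_poly intr P).[x] ^+ m).
Proof.
by do ![split]; move=> *;
  rewrite ?map_polyX ?map_polyC ?rmorph1 ?rmorphD ?rmorphM ?rmorphN ?rmorphXn /= !hornerE.
Qed.

Lemma genus_one_witnesses (K : fieldType) (l : nat) (c : int) (T A : ratfun K)
    (t := tvar K) (D := t + c%:~R * (t - 1) ^+ 2) (m := (l.-1)./2) :
  prime l -> odd l -> (l%:Z %| 4 * c - 1)%Z ->
  equal_up_to l (D / (t - 1) * (1 - t ^+ 2) ^+ m) T -> equal_up_to 1 D A ->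
  exists (Dtilde D : ratfun K) (f : int_laurent),
    [/\ equal_up_to l Dtilde T, equal_up_to 1 D A,
        Dtilde = D / (t - 1) * laurent_at f t * laurent_at f (- t)
      & laurent_congr l ((t + 1) ^+ m * laurent_at f t) (D ^+ m)].
Proof.
move=> l_prime l_odd cl DT DA.
have lE : l = m.*2.+1.
  by rewrite /m even_halfK ?prednK ?prime_gt0 //; case: (l) l_odd => //= k /negbTE ->.
(* With [f = (1 + t)^m] the product [f(t) f(-t)] is [(1 - t^2)^m]. *)
exists (D / (t - 1) * (1 - t ^+ 2) ^+ m), D, (laurent_of_poly ((1 + 'X) ^+ m)).
rewrite !laurent_at_poly !horner_intr !mulr1z; split=> //.
  by rewrite -[RHS]mulrA -exprMn [(1 + t) * _]mulrC -subr_sqr expr1n.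
have [H HE] := genus_one_congr l_prime lE cl.
exists (laurent_of_poly (l%:R * H)); split.
  by rewrite laurent_at_poly -HE !horner_intr !mulr1z.
move=> k; rewrite laurent_of_polyE; case: k => // k.
by rewrite -polyC_natr coefCM dvdz_mulr // natz.
Qed.

Lemma quarter_first (q m : nat) : q.+1 = (4 * m)%N -> 4 * m%:Z - 1 = q%:Z.
Proof. by lia. Qed.

Lemma quarter_second (q m : nat) : q = (4 * m).+1 -> 4 * - m%:Z - 1 = - q%:Z.
Proof. by lia. Qed.

(** * The two families together, and the conclusion *)

Section GenusOne.
Variables (K : fieldType) (p q r s n : nat) (phi : knot_group p q -> 'M[K]_n.+2).
Variable z : bool -> 'I_n.+2.
Hypothesis phiE : forall b, phi (pres_gen _ b) = refl K (z b).
Hypothesis zu : z gen_a - z gen_b \is a GRing.unit.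
Hypotheses (n_odd : odd n) (l0 : n.+2%:R != 0 :> K) (two0 : 2%:R != 0 :> K).
Hypotheses (l_prime : prime n.+2) (l_odd : odd n.+2) (l_dvd_q : (n.+2 %| q)%N).
Hypotheses (r0 : (0 < r)%N) (s0 : (0 < s)%N) (pE : q = (p + 2 * s)%N).
Local Notation t := (tvar K).

Let l0' := ratfun_natr_neq0 l0.
Let two0' := ratfun_natr_neq0 two0.

Lemma genus_one_factorization :
  q.+1 = (4 * (r * s))%N \/ q = (4 * (r * s)).+1 ->
  exists (Dtilde D : ratfun K) (f : int_laurent),
    [/\ equal_up_to n.+2 Dtilde (twisted_alexander phi),
        equal_up_to 1 D (alexander K p q),
        Dtilde = D / (t - 1) * laurent_at f t * laurent_at f (- t)
      & laurent_congr n.+2 ((t + 1) ^+ (n.+2.-1)./2 * laurent_at f t)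
                        (D ^+ (n.+2.-1)./2)].
Proof.
have t0 := tvar_neq0 K; have t1 := tvar_neq1 K; have tN1 := tvar_neqN1 K.
case=> qE.
- have cE : ((r * s)%N%:Z)%:~R = (r * s)%N%:R :> ratfun K by [].
  apply: (@genus_one_witnesses _ _ (r * s)%N%:Z) => //; rewrite ?cE.
  + by rewrite (quarter_first qE).
  + apply: (@twisted_equal_up_to _ _ _ _ phi z phiE n_odd l0 0).
    have -> : t ^ (- (0 * n.+2%:Z)) = 1 by rewrite mul0r.
    rewrite [1 * _]mul1r.
    exact: (det_two_bridge_first n_odd l0' two0' r0 s0 pE l_dvd_q t0 t1 tN1 zu qE).
  + exists false, 0; rewrite mul0r expr0z mulr1 expr0 [1 * _]mul1r.
    exact/esym/(alexander_first _ r0 s0 pE qE).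
- have cE : (- (r * s)%N%:Z)%:~R = - (r * s)%N%:R :> ratfun K by rewrite mulrNz.
  apply: (@genus_one_witnesses _ _ (- (r * s)%N%:Z)) => //; rewrite ?cE ?[- _ * _]mulNr.
  + by rewrite (quarter_second qE) dvdzE abszN.
  + apply: (@twisted_equal_up_to _ _ _ _ phi z phiE n_odd l0 1).
    have -> : t ^ (- (1 * n.+2%:Z)) = t ^- n.+2 by rewrite mul1r -exprnN.
    exact: (det_two_bridge_second n_odd l0' two0' r0 s0 pE l_dvd_q t0 t1 tN1 zu qE).
  (* The alternating sum equals [t^-1 D] in this family, so the unit [t] is needed. *)
  + exists false, 1; rewrite mul1r expr1z expr0 [1 * _]mul1r.
    rewrite (alexander_second K r0 s0 pE qE) [RHS](mulVKf t0); reflexivity.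
Qed.

End GenusOne.

Theorem corollary16 (R : realType) (p q l : nat)
    (p_odd : odd p) (q_odd : odd q) (p_gt0 : (0 < p)%N) (p_lt_q : (p < q)%N)
    (pq_coprime : coprime p q) (pq_genus1 : genus_one p q)
    (l_prime : prime l) (l_odd : odd l) (l_dvd_q : (l %| q)%N)
    (pi : dihedral l -> 'M[R[i]]_l) (piP : is_pi pi)
    (rho : {multiplicative knot_group p q -> dihedral l})
    (rho_surj : forall d : dihedral l, exists g : knot_group p q, rho g = d) :
  let t := tvar R[i] in
  let phi := fun g : knot_group p q => pi (rho g) in
  exists (Dtilde D : ratfun R[i]) (f : int_laurent),
    [/\ equal_up_to l Dtilde (twisted_alexander phi),
        equal_up_to 1 D (alexander R[i] p q),
        Dtilde = D / (t - 1) * laurent_at f t * laurent_at f (- t)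
      & laurent_congr l ((t + 1) ^+ (l.-1)./2 * laurent_at f t)
                        (D ^+ (l.-1)./2)].
Proof.
(* Writing [l] as [n.+2] turns the matrix indices into the ring Z/l. *)
move=> t phi; case: l l_prime l_odd l_dvd_q pi piP rho rho_surj @phi => [|[|n]] //.
move=> l_prime l_odd l_dvd_q pi piP rho rho_surj phi.
have n_odd : odd n by move: l_odd; rewrite /= negbK.
have [z phiE zu] := phi_gen (unit_two_ord n_odd) l_prime piP rho_surj.
have l0 : n.+2%:R != 0 :> R[i] by rewrite pnatr_eq0.
have two0 : 2%:R != 0 :> R[i] by rewrite pnatr_eq0.
have [r [s [r0 s0 pE qE]]] := genus_oneP pq_coprime (ltn_trans p_gt0 p_lt_q) pq_genus1.
exact: (genus_one_factorization phiE zu n_odd l0 two0 l_prime l_odd l_dvd_q r0 s0 pE qE).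
Qed.
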